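(* Let $H$ be a complex Hilbert space and let $A, B$ be bounded self-adjoint operators on $H$. Then the following conditions are equivalent: (i) $\Delta_x(A) \leq \Delta_x(B)$ holds for all unit vectors $x\in H$ (i.e. for all pure states $|x\rangle\langle x|$); (ii) $\Delta_\rho(A) \leq \Delta_\rho(B)$ holds for all states $\rho$ on $H$; (iii) there exists a Lipschitz function $f\colon \sigma(B)\to\mathbb{R}$ with Lipschitz constant $1$ (i.e. $|f(s)-f(t)|\le |s-t|$ for all $s,t\in\sigma(B)$) such that $A = f(B)$.
   Context: A state on $H$ is a positive trace-class operator $\rho$ on $H$ with trace $1$; for a unit vector $x\in H$, the rank-one projection $|x\rangle\langle x|$ onto the span of $x$ is called a pure state. For a bounded self-adjoint operator $A$ and a state $\rho$, the variance is $\Delta_\rho(A) := \operatorname{Tr}(\rho A^2) - (\operatorname{Tr}(\rho A))^2$. For a unit vector $x\in H$, $\Delta_x(A) := \Delta_{|x\rangle\langle x|}(A) = \langle A^2x, x\rangle - \langle Ax, x\rangle^2$. $\sigma(B)$ denotes the spectrum of $B$, and $f(B)$ is defined by the continuous functional calculus. *)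

(* Defs.v *)
From mathcomp Require Import all_boot all_order all_algebra.
From mathcomp Require Import complex.
From mathcomp Require Import all_classical all_reals all_analysis.
From mathcomp Require summability.

Set Implicit Arguments.
Unset Strict Implicit.
Unset Printing Implicit Defensive.
Import Order.TTheory GRing.Theory Num.Theory.
Import numFieldNormedType.Exports.
Local Open Scope classical_set_scope.
Local Open Scope ring_scope.
Local Open Scope complex_scope.

(* The cast to numClosedFieldType gives R[i] the topology of its modulus.
   The order on R[i] is partial: z <= w means that w - z is real and
   nonnegative; norms of vectors and moduli are elements of R[i]. *)
Notation cplx R := (R[i] : numClosedFieldType).

Section Operators.
Variables (R : realType) (H : completeNormedModType (cplx R)).
Local Notation C := (cplx R).
(* linear in the first argument, conjugate-linear in the second *)
Variable dot : {dot H for @Num.conj C}.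
Implicit Types (T S P A B rho : H -> H) (E F : set H).

(* H is complete for its norm, so that this makes it a Hilbert space. *)
Definition dot_norm := forall x, dot x x = `|x| ^+ 2.

Definition bounded_operator T :=
  linear T /\ exists M : C, forall x, `|T x| <= M * `|x|.

Definition adjoint_of T S := forall x y, dot (T x) y = dot x (S y).

Definition self_adjoint T := adjoint_of T T.

Definition positive_operator T := forall x, 0 <= dot (T x) x.

Definition orthonormal_set E :=
  forall e f, E e -> E f -> dot e f = (e == f)%:R.

Definition orthonormal_basis E :=
  orthonormal_set E /\ forall F, orthonormal_set F -> E `<=` F -> F = E.

(* An arbitrary orthonormal basis; H need not be separable. Neither being
   trace-class nor the trace of a trace-class operator depends on it. *)
Definition onb : set H := xget set0 orthonormal_basis.

(* P is |T|, the positive square root of T^* T. *)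
Definition absolute_value T P :=
  [/\ bounded_operator P, positive_operator P &
      exists2 S, adjoint_of T S & P \o P = S \o T].

Definition trace_class T :=
  bounded_operator T /\
  exists2 P, absolute_value T P &
    (\esum_(e in onb) (complex.Re (dot (P e) e))%:E < +oo)%E.

(* summability.sum is the limit of the net of the finite partial sums *)
Definition trace T : C :=
  summability.sum (fun e => if e \in onb then dot (T e) e else 0 : C).

Definition state rho :=
  [/\ positive_operator rho, trace_class rho & trace rho = 1].

(* |x><x| *)
Definition pure_state (x : H) : H -> H := fun y => dot y x *: x.

Definition state_variance rho A : C :=
  trace (rho \o A \o A) - trace (rho \o A) ^+ 2.

Definition spectrum B : set C :=
  [set l | ~ exists2 S, bounded_operator S &
             forall x, S (B x - l *: x) = x /\ B (S x) - l *: S x = x].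

Definition continuous_on_spectrum B (f : C -> C) :=
  {within spectrum B, continuous f}.

(* phi is a unital *-homomorphism from the continuous functions on the spectrum
   of B to the bounded operators, mapping the identity function to B. The
   functions are represented by total ones, of which only the values on the
   spectrum matter (cfc_ext). Such a phi is automatically isometric, and when B
   is self-adjoint it exists and is unique on continuous functions. *)
Record is_cfc B (phi : (C -> C) -> H -> H) : Prop := {
  cfc_bounded : forall f, continuous_on_spectrum B f ->
    bounded_operator (phi f) ;
  cfc_ext : forall f g, continuous_on_spectrum B f ->
    continuous_on_spectrum B g ->
    (forall z, spectrum B z -> f z = g z) -> phi f = phi g ;
  cfc_one : phi (fun=> 1) = id ;
  cfc_id : phi id = B ;
  cfc_add : forall f g, continuous_on_spectrum B f ->
    continuous_on_spectrum B g -> phi (f \+ g) = phi f \+ phi g ;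
  cfc_scale : forall (a : C) f, continuous_on_spectrum B f ->
    phi (fun z => a * f z) = (fun x => a *: phi f x) ;
  cfc_mul : forall f g, continuous_on_spectrum B f ->
    continuous_on_spectrum B g -> phi (f \* g) = phi f \o phi g ;
  cfc_conj : forall f, continuous_on_spectrum B f ->
    adjoint_of (phi f) (phi (fun z => Num.conj (f z))) }.

Definition cfc B : (C -> C) -> H -> H :=
  xget (fun _ _ => 0) [set phi | is_cfc B phi].

End Operators.

(* Main.v *)
(* The variance of A at a unit vector x is the minimum over a of |A x - a x|^2,
   so (i) says that A maps every x at most as far from the line through x as B
   does. A spectral subspace of B for a small interval around s is thus nearly
   an eigenspace of A, for a value f s; comparing the variances at u + v, for
   approximate eigenvectors u, v at s and t, gives |f s - f t| <= |s - t|. Cutting x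
   into N pieces with a partition of unity of mesh 1/N on the spectrum, the errors
   of A - f(B) on the pieces are O(1/N) times their norms, hence by the Cauchy-Schwarz
   inequality O(1/sqrt N) in total, so that A = f(B).
   Conversely, if f is 1-Lipschitz and m is the expectation of B, then f extends to m,
   (f(B) - f m)^2 <= (B - m)^2, and the trace against a state is monotone. *)

Require Import Defs.
From mathcomp Require Import all_boot all_order all_algebra.
From mathcomp Require Import complex finmap.
From mathcomp Require Import all_classical all_reals all_analysis.
From mathcomp Require Import ring lra.
Set Implicit Arguments.
Unset Strict Implicit.
Unset Printing Implicit Defensive.
Import Order.TTheory GRing.Theory Num.Theory.
Import numFieldNormedType.Exports.
Local Open Scope classical_set_scope.
Local Open Scope ring_scope.
Local Open Scope complex_scope.

(** No spectral projections are used. A vector [w] counts as spectral for the interval of radius [d]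
    around [s] when [|(B - s)^n w|] grows at most like [d^n]; this condition is linear in [w] and
    holds for every [f(B) x] with [f] supported in that interval, so the continuous calculus
    suffices. Such a subspace is nearly an eigenspace of [A] for the following reason: if orthogonal
    unit vectors [u], [v] in it had very different expectations of [A], then [A (u + v)] would be
    far from the line through [u + v], while [B (u + v)] is close to it. Since [cfc] is a chosen
    object, its existence has to be proved. Self-adjointness turns invertibility of [B - z] into a
    lower bound, factorization carries this over to polynomials, and the resulting norm bound
    extends the polynomial calculus by uniform limits. For states the obstacle is that a trace is
    only the limit of a net of finite sums over a possibly uncountable basis. With [rho = r^2], the
    trace of [rho T] becomes the sum of the [<T r f, r f>], where monotonicity is visible; moving
    one factor [r] across requires control of Hilbert-Schmidt tails. *)

Local Notation Re := complex.Re.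
Local Notation Im := complex.Im.

(** * Complex scalars and the real inner product *)

Section ComplexFacts.
Variable R : realType.
Local Notation C := (cplx R).
Implicit Types z w : C.

Lemma cReD z w : Re (z + w) = Re z + Re w. Proof. by case: z; case: w. Qed.
Lemma cImD z w : Im (z + w) = Im z + Im w. Proof. by case: z; case: w. Qed.
Lemma cReN z : Re (- z) = - Re z. Proof. by case: z. Qed.
Lemma cImN z : Im (- z) = - Im z. Proof. by case: z. Qed.
Lemma cReM z w : Re (z * w) = Re z * Re w - Im z * Im w.
Proof. by case: z; case: w. Qed.
Lemma cImM z w : Im (z * w) = Re z * Im w + Im z * Re w.
Proof. by case: z; case: w. Qed.
Lemma cReJ z : Re (Num.conj z) = Re z. Proof. by case: z. Qed.
Lemma cImJ z : Im (Num.conj z) = - Im z. Proof. by case: z. Qed.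
Lemma complex_eq z w : Re z = Re w -> Im z = Im w -> z = w.
Proof. by case: z => a b; case: w => c d /= -> ->. Qed.

Definition cabs z : R := Re `|z|.
Lemma cabsE z : `|z| = (cabs z)%:C.
Proof. by rewrite /cabs normc_def. Qed.
Lemma cabs_ge0 z : 0 <= cabs z.
Proof. by rewrite /cabs normc_def /= sqrtr_ge0. Qed.
Lemma cabs2 z : cabs z ^+ 2 = Re z ^+ 2 + Im z ^+ 2.
Proof. by rewrite /cabs normc_def /= sqr_sqrtr // addr_ge0 ?sqr_ge0. Qed.
Lemma cabsM z w : cabs (z * w) = cabs z * cabs w.
Proof. by rewrite {1}/cabs normrM !cabsE cReM /= mul0r subr0. Qed.
Lemma cabsD z w : cabs (z + w) <= cabs z + cabs w.
Proof. by have := ler_normD z w; rewrite !cabsE -raddfD /= lecR. Qed.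
Lemma cabsN z : cabs (- z) = cabs z. Proof. by rewrite /cabs normrN. Qed.
Lemma cabsR (a : R) : cabs a%:C = `|a|.
Proof. by rewrite /cabs normc_def /= expr0n addr0 sqrtr_sqr. Qed.
Lemma cabsJ z : cabs (Num.conj z) = cabs z.
Proof. by rewrite /cabs norm_conjC. Qed.
Lemma cabs_eq0 z : cabs z = 0 -> z = 0.
Proof. by move=> h; apply/eqP; rewrite -normr_eq0 cabsE h. Qed.
Lemma Re_le_cabs z : `|Re z| <= cabs z.
Proof.
rewrite -[X in X <= _]sqrtr_sqr -[X in _ <= X](ger0_norm (cabs_ge0 z)) -sqrtr_sqr.
by rewrite ler_sqrt ?sqr_ge0 // cabs2 lerDl sqr_ge0.
Qed.
Lemma mulJ z : z * Num.conj z = (cabs z ^+ 2)%:C.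
Proof.
by apply: complex_eq; rewrite ?cReM ?cImM cReJ cImJ ?cabs2 /=; ring.
Qed.
Lemma le_cplx z w : z <= w -> Re z <= Re w.
Proof. by rewrite lecE => /andP[]. Qed.
End ComplexFacts.

Section Basics.
Variables (R : realType) (H : completeNormedModType (cplx R)).
Local Notation C := (cplx R).

(** Norms in [H] take values in the partially ordered [C]; their real parts let estimates be settled
    by real arithmetic. *)
Definition rn (x : H) : R := Re `|x|.

Lemma normE x : `|x| = (rn x)%:C :> C.
Proof.
rewrite /rn; have := normr_ge0 x; case: (`|x|) => a b /=.
by rewrite lecE /= => /andP[/eqP -> _].
Qed.
Lemma rn_ge0 x : 0 <= rn x.
Proof. by have := normr_ge0 x; rewrite normE ler0c. Qed.
Lemma rn0 : rn 0 = 0. Proof. by rewrite /rn normr0. Qed.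
Lemma rnN x : rn (- x) = rn x. Proof. by rewrite /rn normrN. Qed.
Lemma rnD x y : rn (x + y) <= rn x + rn y.
Proof. by have := ler_normD x y; rewrite !normE -raddfD /= lecR. Qed.
Lemma rnB x y : rn (x - y) <= rn x + rn y.
Proof. by rewrite -(rnN y); exact: rnD. Qed.
Lemma rnBC x y : rn (x - y) = rn (y - x).
Proof. by rewrite -rnN opprB. Qed.
Lemma rnZ (a : C) x : rn (a *: x) = cabs a * rn x.
Proof. by rewrite {1}/rn normrZ normE cabsE cReM /= mul0r subr0. Qed.
Lemma rnZr (a : R) x : rn (a%:C *: x) = `|a| * rn x.
Proof. by rewrite rnZ cabsR. Qed.
Lemma rn_eq0 x : rn x = 0 -> x = 0.
Proof. by move=> h; apply/eqP; rewrite -normr_eq0 normE h. Qed.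
Lemma rn_gt0 x : x != 0 -> 0 < rn x.
Proof. by move=> x0; rewrite lt_neqAle rn_ge0 andbT eq_sym; apply: contra x0 => /eqP/rn_eq0->. Qed.
Lemma rnD3 z x y : rn (x - y) <= rn (x - z) + rn (z - y).
Proof. by have := rnD (x - z) (z - y); rewrite addrA subrK. Qed.

Definition tends (u : nat -> H) (l : H) :=
  forall e : R, 0 < e -> exists N, forall n, (N <= n)%N -> rn (u n - l) <= e.

Lemma cauchy_tends (u : nat -> H) :
  (forall e : R, 0 < e -> exists N, forall m n, (N <= m)%N -> (N <= n)%N ->
     rn (u m - u n) <= e) -> exists l, tends u l.
Proof.
move=> cu; suff /cvg_ex[l ul] : cvg (u @ \oo).
  exists l => e e0; have e0' : (0 : C) < e%:C by rewrite ltcR.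
  have /cvgrPdist_le/(_ _ e0')[N _ hN] := ul.
  by exists N => n Nn; have := hN n Nn; rewrite normE lecR rnBC.
apply: cauchy_cvg; apply: cauchy_exP => e e0.
have re : (0 : R) < Re e / 2 by move: e0; rewrite ltcE => /andP[_ /= ?]; apply: divr_gt0.
have [N hN] := cu _ re; exists (u N), N => // n /= Nn; rewrite -ball_normE /=.
rewrite normE (_ : e = (Re e)%:C) ?ltcR.
  by apply: (le_lt_trans (hN _ _ (leqnn N) Nn)); lra.
by rewrite RRe_real // realE ltW.
Qed.

Lemma rn_small x : (forall e : R, 0 < e -> rn x <= e) -> x = 0.
Proof.
move=> h; apply: rn_eq0; apply/eqP; rewrite eq_le rn_ge0 andbT.
by apply/ler_addgt0Pr => e e0; rewrite add0r; exact: h.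
Qed.

Lemma tends_le u l (y : H) (c : R) : tends u l ->
  (exists N, forall n, (N <= n)%N -> rn (u n - y) <= c) -> rn (l - y) <= c.
Proof.
move=> h [M hM]; apply/ler_addgt0Pr => e e0; have [N hN] := h _ e0.
have := hN _ (leq_maxl N M); have := hM _ (leq_maxr N M).
by have := rnD3 (u (maxn N M)) l y; rewrite (rnBC l (u _)); lra.
Qed.

Section Dot.
Variable dot : {dot H for @Num.conj C}.
Hypothesis hdot : dot_norm dot.

Lemma dotC x y : dot x y = Num.conj (dot y x).
Proof. by rewrite (hermC dot) expr0 mul1r. Qed.
Lemma dotDl x y z : dot (x + y) z = dot x z + dot y z. Proof. exact: linearDl. Qed.
Lemma dotDr x y z : dot z (x + y) = dot z x + dot z y. Proof. exact: linearDr. Qed.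
Lemma dotZl a x y : dot (a *: x) y = a * dot x y. Proof. exact: linearZl_LR. Qed.
Lemma dotZr a x y : dot x (a *: y) = Num.conj a * dot x y.
Proof. by rewrite linearZr. Qed.
Lemma dotNl x y : dot (- x) y = - dot x y. Proof. exact: linearNl. Qed.
Lemma dotNr x y : dot x (- y) = - dot x y. Proof. exact: linearNr. Qed.
Lemma dot0l x : dot 0 x = 0. Proof. exact: linear0l. Qed.
Lemma dot0r x : dot x 0 = 0. Proof. exact: linear0r. Qed.

Definition redot x y : R := Re (dot x y).
Local Notation rd := redot.
Lemma rdC x y : rd x y = rd y x. Proof. by rewrite /rd dotC cReJ. Qed.
Lemma rdDl x y z : rd (x + y) z = rd x z + rd y z. Proof. by rewrite /rd dotDl cReD. Qed.
Lemma rdDr x y z : rd z (x + y) = rd z x + rd z y. Proof. by rewrite /rd dotDr cReD. Qed.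
Lemma rdNl x y : rd (- x) y = - rd x y. Proof. by rewrite /rd dotNl cReN. Qed.
Lemma rdNr x y : rd x (- y) = - rd x y. Proof. by rewrite /rd dotNr cReN. Qed.
Lemma rdZl (a : R) x y : rd (a%:C *: x) y = a * rd x y.
Proof. by rewrite /rd dotZl cReM /= mul0r subr0. Qed.
Lemma rdZr (a : R) x y : rd x (a%:C *: y) = a * rd x y.
Proof. by rewrite rdC rdZl rdC. Qed.
Lemma rd0l x : rd 0 x = 0. Proof. by rewrite /rd dot0l. Qed.
Lemma rd0r x : rd x 0 = 0. Proof. by rewrite /rd dot0r. Qed.
Definition rdE := (rdDl, rdDr, rdNl, rdNr, rdZl, rdZr).

Lemma dotxx x : dot x x = (rn x ^+ 2)%:C.
Proof. by rewrite hdot normE rmorphXn. Qed.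
Lemma rdxx x : rd x x = rn x ^+ 2.
Proof. by rewrite /rd dotxx. Qed.
Lemma rd_le x y : `|rd x y| <= rn x * rn y.
Proof.
suff h u v : rd u v <= rn u * rn v.
  by rewrite ler_norml h andbT lerNl -rdNl; apply: le_trans (h _ _) _; rewrite rnN.
have [->|/rn_gt0 u0] := eqVneq u 0; first by rewrite rd0l rn0 mul0r.
have [->|/rn_gt0 v0] := eqVneq v 0; first by rewrite rd0r rn0 mulr0.
(* This square equals [2 |u| |v| (|u| |v| - <u, v>)], with a positive first factor. *)
have := sqr_ge0 (rn ((rn v)%:C *: u - (rn u)%:C *: v)).
rewrite -rdxx !rdE !rdxx (rdC v u) => h.
have {}h : 0 <= 2 * (rn u * rn v) * (rn u * rn v - rd u v) by nra.
by rewrite pmulr_rge0 ?mulr_gt0 // subr_ge0 in h.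
Qed.

Lemma cabs_dot x y : cabs (dot x y) <= rn x * rn y.
Proof.
have [->|h] := eqVneq (dot x y) 0; first by rewrite /cabs normr0 mulr_ge0 ?rn_ge0.
have c0 : 0 < cabs (dot x y).
  by rewrite lt_neqAle cabs_ge0 andbT eq_sym; apply: contra h => /eqP/cabs_eq0->.
(* The scalar [dot x y] rotates [y] so that the inner product becomes the real number
   [|dot x y|^2]. *)
have := rd_le x (dot x y *: y); rewrite {1}/rd dotZr mulrC mulJ /= rnZ.
rewrite ger0_norm ?sqr_ge0 // expr2 mulrCA ler_pM2l //.
Qed.

Lemma rn2D x y : rn (x + y) ^+ 2 = rn x ^+ 2 + rn y ^+ 2 + 2 * rd x y.
Proof. by rewrite -!rdxx !rdE (rdC y x); ring. Qed.
Lemma rn2B x y : rn (x - y) ^+ 2 = rn x ^+ 2 + rn y ^+ 2 - 2 * rd x y.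
Proof. by rewrite -!rdxx !rdE (rdC y x); ring. Qed.

Lemma dot_ext x y : (forall z, rd x z = rd y z) -> x = y.
Proof.
move=> h; apply/eqP; rewrite -subr_eq0; apply/eqP/rn_eq0/eqP.
by rewrite -[_ == _](expf_eq0 _ 2) -rdxx rdDl rdNl h subrr.
Qed.
End Dot.
End Basics.

(** * Bounded operators *)

Section Operators.
Variables (R : realType) (H : completeNormedModType (cplx R)).
Local Notation C := (cplx R).
Implicit Types (T S : H -> H).

Lemma linD T x y : linear T -> T (x + y) = T x + T y.
Proof. by move=> lT; have := lT 1 x y; rewrite !scale1r. Qed.
Lemma lin0 T : linear T -> T 0 = 0.
Proof. by move=> lT; have := lT (-1) 0 0; rewrite !scaleN1r !addNr. Qed.
Lemma linZ T a x : linear T -> T (a *: x) = a *: T x.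
Proof. by move=> lT; have := lT a x 0; rewrite (lin0 lT) !addr0. Qed.
Lemma linN T x : linear T -> T (- x) = - T x.
Proof. by move=> lT; rewrite -scaleN1r (linZ _ _ lT) scaleN1r. Qed.
Lemma linB T x y : linear T -> T (x - y) = T x - T y.
Proof. by move=> lT; rewrite (linD _ _ lT) (linN _ lT). Qed.
Lemma lin_sum T I (r : seq I) (P : pred I) (F : I -> H) : linear T ->
  T (\sum_(i <- r | P i) F i) = \sum_(i <- r | P i) T (F i).
Proof.
move=> lT; elim/big_rec2: _ => [|i y x _ <-]; first exact: lin0.
by rewrite linD.
Qed.

Lemma bop_lin T : bounded_operator T -> linear T. Proof. by case. Qed.

Lemma bop_bound T : bounded_operator T ->
  exists2 M : R, 0 < M & forall x, rn (T x) <= M * rn x.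
Proof.
case=> _ [M hM]; exists (`|Re M| + 1); first by rewrite ltr_wpDl.
move=> x; have := le_cplx (hM x); rewrite !normE cReM /= mulr0 subr0 => /le_trans; apply.
by rewrite ler_wpM2r ?rn_ge0 //; have := ler_norm (Re M); lra.
Qed.

Lemma bop_intro T (M : R) : linear T -> (forall x, rn (T x) <= M * rn x) ->
  bounded_operator T.
Proof.
move=> lT hM; split=> //; exists M%:C => x.
by rewrite !normE -rmorphM lecR.
Qed.

Lemma bop_id : bounded_operator (@id H).
Proof. by apply: (@bop_intro _ 1) => // x; rewrite mul1r. Qed.
Lemma bop_comp T S : bounded_operator T -> bounded_operator S ->
  bounded_operator (T \o S).
Proof.
move=> bT bS; have [M M0 hM] := bop_bound bT; have [N N0 hN] := bop_bound bS.
apply: (@bop_intro _ (M * N)) => [a x y|x] /=.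
  by rewrite (bop_lin bS) (bop_lin bT).
by apply: le_trans (hM _) _; rewrite -mulrA ler_pM2l.
Qed.
Lemma bop_add T S : bounded_operator T -> bounded_operator S ->
  bounded_operator (T \+ S).
Proof.
move=> bT bS; have [M M0 hM] := bop_bound bT; have [N N0 hN] := bop_bound bS.
apply: (@bop_intro _ (M + N)) => [a x y|x] /=.
  by rewrite (bop_lin bS) (bop_lin bT) scalerDr addrACA.
by apply: le_trans (rnD _ _) _; rewrite mulrDl lerD.
Qed.
Lemma bop_scale (a : C) T : bounded_operator T ->
  bounded_operator (fun x => a *: T x).
Proof.
move=> bT; have [M M0 hM] := bop_bound bT.
apply: (@bop_intro _ (cabs a * M)) => [b x y|x] /=.
  by rewrite (bop_lin bT) scalerDr !scalerA mulrC.
by rewrite rnZ -mulrA ler_wpM2l // cabs_ge0.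
Qed.
Lemma bop_shift (a : C) T : bounded_operator T ->
  bounded_operator (fun x => T x - a *: x).
Proof.
move=> bT; have := bop_add bT (bop_scale (- a) bop_id).
by congr bounded_operator; apply: funext => x /=; rewrite scaleNr.
Qed.

(** The solution is the fixed point of [y |-> x + T y]. The iterates from 0 stay in the ball of
    radius [|x| / (1 - k)], and all iterates after the n-th differ from it by at most [k^n] times
    this radius. *)
Lemma neumann T (k : R) : linear T -> 0 <= k < 1 ->
  (forall x, rn (T x) <= k * rn x) -> forall x, exists y, y - T y = x.
Proof.
move=> lT /andP[k0 k1] hT x; pose u n := iter n (fun y => x + T y) 0.
pose B := rn x / (1 - k); have k1' : 0 < 1 - k by lra.
have B0 : 0 <= B by rewrite divr_ge0 ?rn_ge0 // ltW.
have uB n : rn (u n) <= B.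
  elim: n => [|n IH] /=; first by rewrite rn0.
  apply: le_trans (rnD _ _) _.
  have : rn (T (u n)) <= k * B by apply: le_trans (hT _) _; rewrite ler_wpM2l.
  have : (1 - k) * B = rn x by rewrite /B mulrCA divff ?mulr1 // gt_eqF.
  lra.
have udiff n m : rn (u (n + m)%N - u n) <= k ^+ n * B.
  elim: n => [|n IH]; first by rewrite add0n subr0 mul1r.
  rewrite addSn /= opprD addrACA subrr add0r -(linB _ _ lT).
  by apply: le_trans (hT _) _; rewrite exprS -mulrA ler_wpM2l.
have geo e : 0 < e -> exists N, forall n, (N <= n)%N -> k ^+ n * B <= e.
  move=> e0; have B1 : 0 < B + 1 by lra.
  have /cvgrPdist_le/(_ _ (divr_gt0 e0 B1))[N _ hN] : (k ^+ n @[n --> \oo] --> (0 : R)).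
    by apply: cvg_expr; rewrite ger0_norm.
  exists N => n Nn; have := hN n Nn; rewrite sub0r normrN ger0_norm ?exprn_ge0 //.
  rewrite ler_pdivlMr //; apply: le_trans; rewrite ler_wpM2l ?exprn_ge0 //; lra.
have [l ul] : exists l, tends u l.
  apply: cauchy_tends => e e0; have [N hN] := geo _ e0; exists N => m n Nm Nn.
  wlog mn : m n Nm Nn / (n <= m)%N.
    by move=> h; case: (leqP n m) => [|/ltnW] ?; [|rewrite rnBC]; apply: h.
  by rewrite -(subnKC mn); apply: le_trans (udiff _ _) (hN _ Nn).
exists l; apply/eqP; rewrite subr_eq -subr_eq0; apply/eqP/rn_small => e e0.
have e2 : 0 < e / 2 by lra.
have [N hN] := ul _ e2; have := hN _ (leqnn N); have := hN _ (leqnSn N).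
move=> a b; apply: le_trans (rnD3 (u N.+1) _ _) _; rewrite rnBC.
suff : rn (u N.+1 - (x + T l)) <= e / 2 by lra.
rewrite /= opprD addrACA subrr add0r -(linB _ _ lT); apply: le_trans (hT _) _.
by apply: le_trans (ler_wpM2l k0 b) _; rewrite ler_piMl ?ltW.
Qed.

Section Adjoint.
Variable dot : {dot H for @Num.conj C}.
Hypothesis hdot : dot_norm dot.
Local Notation rd := (redot dot).

Lemma rd_adj T S x y : adjoint_of dot T S -> rd (T x) y = rd x (S y).
Proof. by rewrite /redot => ->. Qed.

Lemma adj_sym T S : adjoint_of dot T S -> adjoint_of dot S T.
Proof. by move=> h x y; rewrite dotC -h -dotC. Qed.

Lemma adj_comp T T' S S' : adjoint_of dot T S -> adjoint_of dot T' S' ->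
  adjoint_of dot (T \o T') (S' \o S).
Proof. by move=> h h' x y /=; rewrite h h'. Qed.

Lemma adj_shift T S a : adjoint_of dot T S ->
  adjoint_of dot (fun x => T x - a *: x) (fun x => S x - Num.conj a *: x).
Proof.
by move=> h x y; rewrite dotDl dotDr dotNl dotNr dotZl dotZr conjCK h.
Qed.

Lemma adj_bound T S (M : R) : adjoint_of dot T S ->
  (forall x, rn (T x) <= M * rn x) -> forall x, rn (S x) <= M * rn x.
Proof.
move=> adj hM x; have [->|/rn_gt0 h] := eqVneq (S x) 0.
  by rewrite rn0; apply: le_trans (rn_ge0 (T x)) (hM _).
rewrite -(ler_pM2r h) -expr2 -(rdxx hdot) -(rd_adj _ _ adj).
apply: le_trans (ler_norm _) _; apply: le_trans (rd_le hdot _ _) _.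
by rewrite mulrAC ler_wpM2r ?rn_ge0.
Qed.

(** For a suitable [t > 0] the operator [V = 1 - t Ts T] is a contraction, so [Ts (T y) = x] is
    solvable by iteration; commutation then makes [Ts y] a preimage of [x] under [T]. *)
Lemma bounded_below_invertible T Ts (c : R) : bounded_operator T -> linear Ts ->
  adjoint_of dot T Ts -> (forall x, T (Ts x) = Ts (T x)) -> 0 < c ->
  (forall x, c * rn x <= rn (T x)) ->
  exists2 S, bounded_operator S & forall x, S (T x) = x /\ T (S x) = x.
Proof.
move=> bT lTs adj comm c0 hc; have lT := bop_lin bT.
(* Adding [c] ensures [c <= M], so that [s = c^2 / M^2] is at most 1. *)
have [M' M'0 hM'] := bop_bound bT; pose M := M' + c.
have M0 : 0 < M by rewrite addr_gt0.
have hM x : rn (T x) <= M * rn x.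
  by apply: le_trans (hM' x) _; rewrite ler_wpM2r ?rn_ge0 // /M; lra.
have hMs := adj_bound adj hM.
pose t := (M ^+ 2)^-1; have M2 : 0 < M ^+ 2 by rewrite exprn_gt0.
have t0 : 0 < t by rewrite invr_gt0.
have tM : t * M ^+ 2 = 1 by rewrite mulVf // gt_eqF.
pose V y := y - t%:C *: Ts (T y).
have lV : linear V.
  move=> a x y; rewrite /V lT lTs scalerDr opprD addrACA scalerBr !scalerA.
  by rewrite [a * _]mulrC.
pose s := t * c ^+ 2.
have s01 : 0 < s <= 1.
  rewrite /s mulr_gt0 ?exprn_gt0 //= -tM ler_pM2l // ler_pXn2r // ?nnegrE ?ltW //.
  by rewrite /M; lra.
(* [|V x|^2 = |x|^2 - 2 t |T x|^2 + t^2 |Ts T x|^2 <= |x|^2 - t |T x|^2 <= (1 - s) |x|^2], and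
   [1 - s <= (1 - s / 2)^2]. *)
pose k := 1 - s / 2.
have hV x : rn (V x) <= k * rn x.
  have k0 : 0 <= k by rewrite /k; lra.
  rewrite -(@ler_pXn2r _ 2) ?nnegrE ?mulr_ge0 ?rn_ge0 //.
  rewrite (rn2B hdot) rnZr gtr0_norm // rdZr (rdC dot x) (rd_adj _ _ (adj_sym adj)) (rdxx hdot).
  have : rn (Ts (T x)) ^+ 2 <= M ^+ 2 * rn (T x) ^+ 2.
    by rewrite -exprMn ler_pXn2r // nnegrE ?mulr_ge0 ?rn_ge0 // ltW.
  have : c ^+ 2 * rn x ^+ 2 <= rn (T x) ^+ 2.
    by rewrite -exprMn ler_pXn2r // nnegrE ?mulr_ge0 ?rn_ge0 // ltW.
  rewrite !exprMn; set a := rn (Ts _) ^+ 2; set b := rn (T x) ^+ 2; set d := rn x ^+ 2.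
  move=> h1 h2; have h3 : t ^+ 2 * a <= t * b.
    rewrite expr2 -mulrA ler_pM2l //; apply: le_trans (ler_wpM2l (ltW t0) h2) _.
    by rewrite mulrA tM mul1r.
  have h4 : s * d <= t * b by rewrite /s -mulrA ler_pM2l.
  have : 0 <= s ^+ 2 * d by rewrite mulr_ge0 ?sqr_ge0.
  by rewrite /k; nra.
have k01 : 0 <= k < 1 by rewrite /k; lra.
have surj x : exists y, T y = x.
  have [y hy] := neumann lV k01 hV (t%:C *: x).
  exists (Ts y); rewrite comm; move: hy; rewrite /V opprB addrC subrK.
  by move/scalerI; apply; rewrite eq_complex /= negb_and gt_eqF.
have [S hS] := choice surj; have inj x y : T x = T y -> x = y.
  move=> h; apply/eqP; rewrite -subr_eq0; apply/eqP/rn_eq0; apply/eqP.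
  have := hc (x - y); rewrite (linB _ _ lT) h subrr rn0 => h'.
  by rewrite eq_le rn_ge0 andbT -(pmulr_rle0 _ c0).
exists S; last by move=> x; split=> //; apply: inj.
apply: (@bop_intro _ c^-1) => [a x y|x]; first by apply: inj; rewrite hS lT !hS.
by have := hc (S x); rewrite hS ler_pdivlMl.
Qed.

End Adjoint.
End Operators.

(** * Spectrum and polynomial calculus of a self-adjoint operator *)

Section Spectrum.
Variables (R : realType) (H : completeNormedModType (cplx R)).
Local Notation C := (cplx R).
Variable dot : {dot H for @Num.conj C}.
Hypothesis hdot : dot_norm dot.
Local Notation rd := (redot dot).
Variable B : H -> H.
Hypotheses (bB : bounded_operator B) (sB : self_adjoint dot B).

Lemma rd_sa x y : rd (B x) y = rd x (B y). Proof. exact: rd_adj. Qed.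
Lemma dot_sa_real x : Im (dot (B x) x) = 0.
Proof. by have := congr1 (@Im R) (sB x x); rewrite [in RHS]dotC cImJ; lra. Qed.

(** [B - l] commutes with its adjoint, so a lower bound alone makes it invertible. With the converse
    below, questions about the spectrum become estimates. *)
Lemma not_spectrum_of_bounded_below (l : C) (c : R) : 0 < c ->
  (forall x, c * rn x <= rn (B x - l *: x)) -> ~ spectrum B l.
Proof.
move=> c0 hc; apply.
have lB := bop_lin bB.
have [||S bS hS] := bounded_below_invertible hdot (bop_shift l bB) _
  (adj_shift l sB) _ c0 hc.
- exact: bop_lin (bop_shift _ bB).
- by move=> x; rewrite !(linB _ _ lB) !(linZ _ _ lB) !scalerBr !scalerA mulrC !opprB
      addrACA [RHS]addrACA; congr (_ + _); rewrite addrC.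
by exists S.
Qed.

Lemma bounded_below_of_not_spectrum (l : C) : ~ spectrum B l ->
  exists2 c : R, 0 < c & forall x, c * rn x <= rn (B x - l *: x).
Proof.
move/contrapT => [S bS hS]; have [M M0 hM] := bop_bound bS.
exists M^-1; first by rewrite invr_gt0.
by move=> x; rewrite ler_pdivrMl // -{1}(hS x).1.
Qed.

(** As [<B x, x>] is real, [|(B - z) x| |x| >= |<(B - z) x, x>| >= |Im z| |x|^2]. *)
Lemma spectrum_real z : spectrum B z -> Im z = 0.
Proof.
move=> sz; apply: contrapT => /eqP h; apply: not_spectrum_of_bounded_below sz.
  by rewrite -normr_gt0 in h; exact: h.
move=> x; have [->|/rn_gt0 x0] := eqVneq x 0; first by rewrite rn0 mulr0 rn_ge0.
rewrite -(ler_pM2r x0); apply: le_trans (cabs_dot hdot _ _).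
rewrite dotDl dotNl dotZl (dotxx hdot) -[X in X <= _](@ger0_norm _) ?mulr_ge0 ?rn_ge0 //.
have -> : dot (B x) x - z * (rn x ^+ 2)%:C = (Re (dot (B x) x) - Re z * rn x ^+ 2)%:C +
   'i * (- (Im z * rn x ^+ 2))%:C.
  have := dot_sa_real x; move: (dot _ _) => w hw.
  by apply: complex_eq; rewrite ?(cReD, cImD, cReN, cImN, cReM, cImM) /= ?hw; ring.
set w := (X in cabs X).
have -> : `|(`|Im z| * rn x * rn x)| = `|Im w|.
  rewrite /w cImD cImM /= !(mul0r, mul1r, mulr0, add0r) normrN !normrM normr_id.
  by rewrite -?mulrA -expr2 ?normrX.
rewrite -ler_sqr ?nnegrE ?cabs_ge0 // cabs2 real_normK ?num_real //.
by rewrite lerDr sqr_ge0.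
Qed.

Lemma spectrumE z : spectrum B z -> z = (Re z)%:C.
Proof. by move/spectrum_real => h; apply: complex_eq. Qed.

Lemma spectrum_bounded : exists2 M : R, 0 < M & forall z, spectrum B z -> `|Re z| <= M.
Proof.
have [M M0 hM] := bop_bound bB; exists M => // z sz; rewrite leNgt; apply/negP => h.
apply: not_spectrum_of_bounded_below sz; first by rewrite -(subr_gt0 M) in h; exact: h.
move=> x; have := rnD (z *: x - B x) (B x); rewrite subrK rnZ rnBC.
have := hM x; have : `|Re z| * rn x <= cabs z * rn x.
  by rewrite ler_wpM2r ?rn_ge0 // Re_le_cabs.
lra.
Qed.

Lemma spectrum_closed (a : R) :
  (forall e, 0 < e -> exists2 b : R, spectrum B b%:C & `|b - a| <= e) ->
  spectrum B a%:C.
Proof.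
move=> h; apply: contrapT => /bounded_below_of_not_spectrum[c c0 hc].
have c2 : 0 < c / 2 by lra.
have [b sb ba] := h _ c2; apply: not_spectrum_of_bounded_below c2 _ sb => x.
have := hc x; have : rn ((b - a)%:C *: x) <= c / 2 * rn x.
  by rewrite rnZr ler_wpM2r ?rn_ge0.
have := rnD (B x - b%:C *: x) ((b - a)%:C *: x).
by rewrite rmorphB scalerBl addrA subrK; lra.
Qed.

Lemma spectrum_nonneg z : positive_operator dot B -> spectrum B z -> 0 <= Re z.
Proof.
move=> pB sz; rewrite leNgt; apply/negP => z0; have zE := spectrumE sz.
apply: not_spectrum_of_bounded_below sz; first by rewrite -oppr_gt0 in z0; exact: z0.
move=> x; have [->|/rn_gt0 x0] := eqVneq x 0; first by rewrite rn0 mulr0 rn_ge0.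
rewrite -(ler_pM2r x0); apply: le_trans (rd_le hdot _ _).
apply: le_trans (ler_norm _); rewrite zE rdDl rdNl rdZl (rdxx hdot) /=.
have := le_cplx (pB x); rewrite /= -/(rd _ _); nra.
Qed.

Definition pev (p : {poly C}) (x : H) : H := \sum_(i < size p) p`_i *: iter i B x.

Implicit Types (p q : {poly C}) (x : H).

Lemma pev_wide p n x : (size p <= n)%N -> pev p x = \sum_(i < n) p`_i *: iter i B x.
Proof.
move=> pn; rewrite /pev (big_ord_widen n (fun i => p`_i *: iter i B x) pn).
rewrite big_mkcond; apply: eq_bigr => i _; case: ltnP => // h.
by rewrite nth_default // scale0r.
Qed.
Lemma pevD p q x : pev (p + q) x = pev p x + pev q x.
Proof.
have le1 := leq_maxl (size p) (size q); have le2 := leq_maxr (size p) (size q).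
rewrite (pev_wide x le1) (pev_wide x le2) (pev_wide x (size_polyD p q)) -big_split.
by apply: eq_bigr => i _; rewrite coefD scalerDl.
Qed.
Lemma pevZ a p x : pev (a *: p) x = a *: pev p x.
Proof.
rewrite (pev_wide x (size_scale_leq a p)) /pev scaler_sumr.
by apply: eq_bigr => i _; rewrite coefZ scalerA.
Qed.
Lemma pevC a x : pev a%:P x = a *: x.
Proof. by rewrite (pev_wide x (size_polyC_leq1 a)) big_ord1 coefC. Qed.
Lemma pevMX p x : pev (p * 'X) x = pev p (B x).
Proof.
have h : (size (p * 'X)%R <= (size p).+1)%N.
  by apply: leq_trans (size_polyMleq _ _) _; rewrite size_polyX addn2.
rewrite (pev_wide x h) big_ord_recl coefMX scale0r add0r.
by apply: eq_bigr => i _; rewrite coefMX /= -iterS iterSr.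
Qed.
Lemma pevX x : pev 'X x = B x.
Proof. by rewrite -['X]mul1r pevMX pevC scale1r. Qed.
Lemma bop_pev p : bounded_operator (pev p).
Proof.
elim/poly_ind: p => [|p c IH].
  apply: (@bop_intro _ _ _ 0) => [a x y|x]; rewrite /pev size_poly0 !big_ord0.
    by rewrite scaler0 addr0.
  by rewrite rn0 mul0r.
have := bop_add (bop_comp IH bB) (bop_scale c (@bop_id _ H)).
congr bounded_operator; apply: funext => x /=.
by rewrite pevD pevMX pevC.
Qed.
Lemma pev_comm p x : pev p (B x) = B (pev p x).
Proof.
rewrite /pev (lin_sum _ _ _ (bop_lin bB)); apply: eq_bigr => i _.
by rewrite (linZ _ _ (bop_lin bB)) -iterS iterSr.
Qed.
Lemma pevM p q x : pev (p * q) x = pev p (pev q x).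
Proof.
elim/poly_ind: p x => [|p c IH] x.
  by rewrite mul0r -!(@polyC0 C) !pevC !scale0r.
by rewrite mulrDl mulrAC !pevD !pevMX IH mul_polyC pevZ pevC pev_comm.
Qed.
Lemma adj_pev p : adjoint_of dot (pev p) (pev (map_poly Num.conj p)).
Proof.
elim/poly_ind: p => [|p c IH] x y.
  by rewrite rmorph0 -!(@polyC0 C) !pevC !scale0r dot0l dot0r.
rewrite rmorphD rmorphM /= map_polyX map_polyC /= !pevD !pevMX !pevC.
by rewrite dotDl dotDr dotZl dotZr IH sB pev_comm conjCK.
Qed.

(** Over [C] the polynomial splits. Every root lies off the spectrum and contributes a factor
    [B - z] that is bounded below; the constants multiply. *)
Lemma pev_bounded_below q : q != 0 -> (forall z, spectrum B z -> q.[z] != 0) ->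
  exists2 c : R, 0 < c & forall x, c * rn x <= rn (pev q x).
Proof.
move=> q0 hq; have [rs hrs] := closed_field_poly_normal q.
have hr z : z \in rs -> ~ spectrum B z.
  move=> zr /hq /negP; apply; rewrite hrs hornerZ mulf_eq0; apply/orP; right.
  by rewrite -/(root _ z) root_prod_XsubC.
have [c c0 hc] : exists2 c : R, 0 < c &
    forall x, c * rn x <= rn (pev (\prod_(z <- rs) ('X - z%:P)) x).
  elim: rs hr {hrs} => [|z rs IH] hr.
    by exists 1 => // x; rewrite big_nil pevC scale1r mul1r.
  have [c c0 hc] := IH (fun w h => hr w (mem_behead (s := z :: rs) h)).
  have [d d0 hd] := bounded_below_of_not_spectrum (hr z (mem_head _ _)).
  exists (d * c); first exact: mulr_gt0.
  move=> x; rewrite big_cons pevM pevD pevX -polyCN pevC scaleNr.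
  by apply: le_trans (hd _); rewrite -mulrA ler_pM2l.
have l0 : 0 < cabs (lead_coef q).
  rewrite lt_neqAle cabs_ge0 andbT eq_sym; apply/eqP => /cabs_eq0/eqP.
  by rewrite lead_coef_eq0 (negPf q0).
move: hrs l0; set l := lead_coef q => hrs l0.
exists (cabs l * c); first exact: mulr_gt0.
by move=> x; rewrite hrs pevZ rnZ -mulrA ler_pM2l.
Qed.

End Spectrum.

(** * The norm of a polynomial in a self-adjoint operator *)

Section NormBound.
Variables (R : realType) (H : completeNormedModType (cplx R)).
Local Notation C := (cplx R).
Variable dot : {dot H for @Num.conj C}.
Hypothesis hdot : dot_norm dot.
Local Notation rd := (redot dot).

(** Let [K] be the norm of [T]. Then [|T^2 x - K^2 x|^2 <= K^2 (K^2 |x|^2 - |T x|^2)], which is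
    small when [|T x|] is close to [K |x|]; so [K^2] is an approximate eigenvalue of [T^2], which
    the lower bound excludes for [K > N]. *)
Lemma self_adjoint_norm_le (T : H -> H) (N : R) : bounded_operator T ->
  self_adjoint dot T -> 0 <= N ->
  (forall K, N < K -> exists2 c : R, 0 < c &
     forall x, c * rn x <= rn (T (T x) - (K ^+ 2)%:C *: x)) ->
  forall x, rn (T x) <= N * rn x.
Proof.
move=> bT sT N0 hN; pose E := [set M : R | 0 <= M /\ forall x, rn (T x) <= M * rn x].
have E0 : E !=set0.
  by have [M M0 hM] := bop_bound bT; exists M; split=> //; exact: ltW.
have lbE : has_lbound E by exists 0 => M [].
have hK x : rn (T x) <= inf E * rn x.
  have [->|/rn_gt0 x0] := eqVneq x 0; first by rewrite (lin0 (bop_lin bT)) rn0 mulr0.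
  by rewrite -ler_pdivrMr //; apply: lb_le_inf => // M [_ hM]; rewrite ler_pdivrMr.
suff KN : inf E <= N.
  by move=> x; apply: le_trans (hK x) _; rewrite ler_wpM2r ?rn_ge0.
rewrite leNgt; apply/negP => NK; have [c c0 hc] := hN _ NK.
set K := inf E in hK NK hc; have K0 : 0 < K by apply: le_lt_trans NK.
have K3 : 0 < 4 * K ^+ 3 by rewrite mulr_gt0 ?exprn_gt0.
(* This gives [K^2 (K^2 - (K - eta)^2) <= 2 eta K^3 <= c^2], against the lower bound [c]; the
   minimum with [K] keeps [K - eta] nonnegative. *)
pose eta := Num.min K (c ^+ 2 / (4 * K ^+ 3)).
have eta0 : 0 < eta by rewrite lt_min K0 divr_gt0 ?exprn_gt0.
have etaK : eta <= K by rewrite ge_min lexx.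
have etac : eta * (4 * K ^+ 3) <= c ^+ 2.
  by rewrite -ler_pdivlMr // ge_min lexx orbT.
have : ~ E (K - eta).
  by move=> /(ge_inf lbE); rewrite -/K; lra.
move/not_andP => [|/existsNP[x /negP]]; first by apply; lra.
rewrite -ltNge => hx; have := hc x.
have x0 : 0 < rn x.
  apply: rn_gt0; apply/eqP => x0; move: hx.
  by rewrite x0 (lin0 (bop_lin bT)) rn0 mulr0 ltxx.
apply/negP; rewrite -ltNge -(@ltr_pXn2r _ 2) ?nnegrE ?mulr_ge0 ?rn_ge0 ?ltW //.
rewrite (rn2B hdot) rnZr ger0_norm ?sqr_ge0 // rdZr (rd_sa sT) (rdxx hdot).
have h1 : rn (T (T x)) ^+ 2 <= K ^+ 2 * rn (T x) ^+ 2.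
  by rewrite -exprMn ler_pXn2r // nnegrE ?mulr_ge0 ?rn_ge0 // ltW.
have h2 : (K - eta) ^+ 2 * rn x ^+ 2 < rn (T x) ^+ 2.
  by rewrite -exprMn ltr_pXn2r // nnegrE ?mulr_ge0 ?rn_ge0 // subr_ge0.
have K2 : 0 < K ^+ 2 by rewrite exprn_gt0.
have x2 : 0 < rn x ^+ 2 by rewrite exprn_gt0.
have h3 : K ^+ 2 * ((K - eta) ^+ 2 * rn x ^+ 2) < K ^+ 2 * rn (T x) ^+ 2 by rewrite ltr_pM2l.
have h4 : (K ^+ 2 * (K ^+ 2 - (K - eta) ^+ 2)) * rn x ^+ 2 <= c ^+ 2 * rn x ^+ 2.
  rewrite ler_pM2r //; apply: le_trans etac.
  have -> : K ^+ 2 * (K ^+ 2 - (K - eta) ^+ 2) = eta * (2 * K ^+ 3) - eta ^+ 2 * K ^+ 2 by ring.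
  have : 0 <= eta ^+ 2 * K ^+ 2 by rewrite mulr_ge0 ?sqr_ge0.
  have : 0 <= eta * K ^+ 3 by rewrite mulr_ge0 ?exprn_ge0 // ltW.
  lra.
rewrite !exprMn; lra.
Qed.

Variable B : H -> H.
Hypotheses (bB : bounded_operator B) (sB : self_adjoint dot B).

(** With no spectrum every [B^2 - K^2] is bounded below, so the norm bound with [N = 0] gives
    [B = 0]; but 0 is off the spectrum too, so [B] is bounded below. *)
Lemma spectrum_empty : (forall z, ~ spectrum B z) -> forall x : H, x = 0.
Proof.
move=> hz x; have hB : forall x, rn (B x) <= 0 * rn x.
  apply: self_adjoint_norm_le => // K K0.
  have [|z /hz//|c c0 hc] := @pev_bounded_below _ _ _ bB ('X^2 - (K ^+ 2)%:C%:P).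
    by rewrite -size_poly_gt0 size_XnsubC.
  exists c => // y; apply: le_trans (hc y) _.
  by rewrite pevD -polyCN pevC expr2 pevMX // pevX scaleNr.
have [c c0 hc] := bounded_below_of_not_spectrum (hz 0).
apply: rn_eq0; apply/eqP; rewrite eq_le rn_ge0 andbT -(pmulr_rle0 _ c0).
by apply: le_trans (hc x) _; rewrite scale0r subr0; have := hB x; rewrite mul0r.
Qed.

(** The norm bound concerns self-adjoint operators, so it is applied to [q(B)] for [q = conj p * p],
    which equals [|p|^2] on the real spectrum; then [|p(B) x|^2 = <q(B) x, x> <= m^2 |x|^2]. *)
Lemma pev_norm_le (p : {poly C}) (m : R) : 0 <= m ->
  (forall z, spectrum B z -> cabs p.[z] <= m) ->
  forall x, rn (pev B p x) <= m * rn x.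
Proof.
move=> m0 hm x; have [[z0 sz0]|none] := pselect (exists z, spectrum B z); last first.
  have /spectrum_empty h : forall z, ~ spectrum B z by move=> z sz; apply: none; exists z.
  by rewrite (h x) (lin0 (bop_lin (bop_pev bB p))) rn0 mulr0.
pose q := map_poly Num.conj p * p.
have qE z : spectrum B z -> q.[z] = (cabs p.[z] ^+ 2)%:C.
  move=> sz; rewrite hornerM -mulJ mulrC; congr (_ * _).
  have {1}-> : z = Num.conj z.
    by apply: complex_eq; rewrite ?cReJ // cImJ (spectrum_real hdot bB sB sz) oppr0.
  by rewrite horner_map.
have sq : self_adjoint dot (pev B q).
  have := adj_pev bB sB q; congr adjoint_of; congr pev.
  rewrite /q rmorphM mulrC /=; congr (_ * _).
  by rewrite -map_poly_comp map_poly_id // => c _ /=; rewrite conjCK.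
have m2 : 0 <= m ^+ 2 by rewrite sqr_ge0.
have := @self_adjoint_norm_le _ _ (bop_pev bB q) sq m2.
have -> : (forall K, m ^+ 2 < K -> exists2 c : R, 0 < c &
     forall x, c * rn x <= rn (pev B q (pev B q x) - (K ^+ 2)%:C *: x)) = True.
  rewrite propeqE; split=> // _ K mK.
  have nz z : spectrum B z -> (q * q - ((K ^+ 2)%:C)%:P).[z] != 0.
    move=> sz; rewrite hornerD hornerN hornerM hornerC qE //.
    rewrite -rmorphM -rmorphB /= eq_complex /= negb_and lt_eqF // subr_lt0.
    rewrite -expr2 ltr_pXn2r ?nnegrE ?sqr_ge0 //; last by apply: le_trans m2 (ltW mK).
    by apply: le_lt_trans mK; rewrite ler_pXn2r ?nnegrE ?cabs_ge0 // hm.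
  (* The value at [z0] shows that [q^2 - K^2] is not the zero polynomial; this is why an empty
     spectrum was treated apart. *)
  have [|c c0 hc] := pev_bounded_below bB _ nz.
    by apply: contra (nz _ sz0) => /eqP->; rewrite horner0.
  exists c => // y; apply: le_trans (hc y) _.
  by rewrite pevD -polyCN pevC pevM // scaleNr.
move=> /(_ I x) h.
rewrite -(@ler_pXn2r _ 2) ?nnegrE ?mulr_ge0 ?rn_ge0 // -(rdxx hdot).
rewrite (rd_adj _ _ (adj_pev bB sB p)) -pevM // exprMn rdC.
apply: le_trans (ler_norm _) _; apply: le_trans (rd_le hdot _ _) _.
by rewrite [X in _ <= _ * X]expr2 mulrA ler_wpM2r ?rn_ge0.
Qed.

End NormBound.

(** * Weierstrass approximation on compact sets of reals *)

Section Bernstein.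
Variable R : realType.
Implicit Types (e : R) (f : nat -> R) (g : R -> R) (K : set R).

(* The Bernstein polynomial sum_k f(k) C(n,k) X^k (1-X)^(n-k), by recursion on n. *)
Fixpoint bernstein n f : {poly R} :=
  if n is n.+1 then (1 - 'X) * bernstein n f + 'X * bernstein n (f \o S) else (f 0%N)%:P.

Lemma natr_gt (x : R) : exists n : nat, x < n%:R.
Proof.
exists (Num.bound `|x|); apply: le_lt_trans (ler_norm x) _.
exact: archi_boundP.
Qed.

Lemma bernstein_le n f f' (t : R) : 0 <= t <= 1 -> (forall k, f k <= f' k) ->
  (bernstein n f).[t] <= (bernstein n f').[t].
Proof.
move=> /andP[t0 t1]; elim: n f f' => [|n IH] f f' ff' /=; first by rewrite !hornerC.
rewrite !(hornerD, hornerM, hornerN, hornerX, hornerC).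
by apply: lerD; apply: ler_wpM2l; rewrite ?subr_ge0 //; apply: IH => k; apply: ff'.
Qed.

(** These are the first two moments of the binomial law with parameters [n] and [t]. *)
Lemma bernstein_quadratic n (a b c t : R) :
  (bernstein n (fun k => a + b * k%:R + c * k%:R ^+ 2)).[t] =
  a + b * (n%:R * t) + c * (n%:R * t * (1 - t) + n%:R ^+ 2 * t ^+ 2).
Proof.
elim: n a b c => [|n IH] a b c /=; first by rewrite hornerC; ring.
have -> : (fun k => a + b * k%:R + c * k%:R ^+ 2) \o S =
  (fun k => (a + b + c) + (b + 2 * c) * k%:R + c * k%:R ^+ 2).
  by apply: funext => k /=; rewrite -natr1; ring.
rewrite !(hornerD, hornerM, hornerN, hornerX, hornerC) !IH -natr1; ring.
Qed.

(** By [|a| <= d / 2 + a^2 / (2 d)], the Lipschitz bound is replaced by one that is quadratic in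
    [k]; the Bernstein operator is monotone, and explicit on quadratics. *)
Lemma lipschitz_approx g (L M e : R) : (forall x y : R, `|g x - g y| <= L * `|x - y|) ->
  0 < M -> 0 < e ->
  exists p : {poly R}, forall x : R, `|x| <= M -> `|p.[x] - g x| <= e.
Proof.
move=> hg M0 e0; wlog L0 : L hg / 0 < L.
  move=> h; apply: (h (`|L| + 1)); last by rewrite ltr_wpDl.
  move=> x y; apply: le_trans (hg x y) _; rewrite ler_wpM2r //.
  by have := ler_norm L; lra.
pose L' := 2 * M * L; have L'0 : 0 < L' by rewrite !mulr_gt0.
(* With this [d] the constant error term [L' d / 2] is [e / 2]. The variance term is at most
   [L'^2 / (8 e n)], which the choice of [n] puts below [e / 2]. *)
pose d := e / L'; have d0 : 0 < d by rewrite divr_gt0.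
have [n hn] : exists n : nat, L' ^+ 2 / (4 * e ^+ 2) < n%:R.
  exact: natr_gt.
have n0 : 0 < n%:R :> R.
  by apply: le_lt_trans hn; rewrite divr_ge0 ?sqr_ge0 // mulr_ge0 ?sqr_ge0.
pose f k := g (- M + 2 * M * (k%:R / n%:R)).
exists (bernstein n f \Po ((2 * M)^-1 *: ('X + M%:P))) => x xM.
rewrite horner_comp hornerZ hornerD hornerX hornerC; set t := _ * _.
have t01 : 0 <= t <= 1.
  have M2 : 0 < 2 * M by lra.
  move: xM; rewrite ler_norml => /andP[h1 h2].
  by apply/andP; split; rewrite /t mulrC ?ler_pdivlMr ?ler_pdivrMr //; lra.
have xE : x = - M + 2 * M * t.
  by rewrite /t mulrA divff ?mul1r ?gt_eqF //; lra.
have key k : `|f k - g x| <= L' * (d / 2 + (k%:R / n%:R - t) ^+ 2 / (2 * d)).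
  rewrite /f xE; apply: le_trans (hg _ _) _.
  have -> : - M + 2 * M * (k%:R / n%:R) - (- M + 2 * M * t) = 2 * M * (k%:R / n%:R - t) by ring.
  rewrite normrM (@ger0_norm _ (2 * M)); last by lra.
  set a := _ - t; have -> : L * (2 * M * `|a|) = L' * `|a| by rewrite /L'; ring.
  rewrite ler_pM2l //.
  have : 0 <= (`|a| - d) ^+ 2 / (2 * d).
    by rewrite divr_ge0 ?sqr_ge0 // mulr_ge0 ?ltW.
  have -> : (`|a| - d) ^+ 2 / (2 * d) = (`|a| ^+ 2) / (2 * d) + d / 2 - `|a|.
    by field; rewrite gt_eqF.
  rewrite real_normK ?num_real //; lra.
pose q k := d / 2 + (k%:R / n%:R - t) ^+ 2 / (2 * d).
have bound s : (bernstein n (fun k => g x + s * (L' * q k))).[t]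
  = g x + s * (e / 2 + L' * (t * (1 - t)) / (2 * d * n%:R)).
  pose a := g x + s * L' * (d / 2 + t ^+ 2 / (2 * d)).
  pose b := - (s * L' * (t / (n%:R * d))); pose c := s * L' / (2 * d * n%:R ^+ 2).
  have -> : (fun k => g x + s * (L' * q k)) =
      (fun k => a + b * k%:R + c * k%:R ^+ 2).
    by apply: funext => k; rewrite /q /a /b /c; field; rewrite !gt_eqF.
  rewrite bernstein_quadratic /a /b /c.
  have -> : e = d * L' by rewrite /d divfK // gt_eqF.
  by field; rewrite !gt_eqF.
have rem : L' * (t * (1 - t)) / (2 * d * n%:R) <= e / 2.
  have t4 : t * (1 - t) <= 1 / 4 by have := sqr_ge0 (t - 1 / 2); nra.
  have dn0 : 0 < 2 * d * n%:R by do 2?[apply: mulr_gt0 => //].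
  rewrite ler_pdivrMr //.
  have h : L' ^+ 2 <= 4 * e ^+ 2 * n%:R.
    by move: hn; rewrite ltr_pdivrMr ?mulr_gt0 ?exprn_gt0 // mulrC => /ltW.
  have -> : e / 2 * (2 * d * n%:R) = e ^+ 2 * n%:R / L' by rewrite /d; field; rewrite gt_eqF.
  rewrite ler_pdivlMr //; have L2 : 0 < L' ^+ 2 by rewrite exprn_gt0.
  have : L' ^+ 2 * (t * (1 - t)) <= L' ^+ 2 * (1 / 4) by rewrite ler_pM2l.
  have -> : L' * (t * (1 - t)) * L' = L' ^+ 2 * (t * (1 - t)) by ring.
  lra.
rewrite ler_norml; apply/andP; split.
  rewrite lerBrDl; apply: le_trans (bernstein_le (f := fun k => g x + -1 * (L' * q k)) n t01 _).
    by rewrite bound; lra.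
  by move=> k; have := key k; rewrite -/(q k) ler_norml => /andP[]; lra.
rewrite lerBlDl; apply: le_trans (bernstein_le (f' := fun k => g x + 1 * (L' * q k)) n t01 _) _; last first.
  by rewrite bound; lra.
by move=> k; have := key k; rewrite -/(q k) ler_norml => /andP[]; lra.
Qed.

Definition cont_on K g := forall x : R, K x -> forall e, 0 < e ->
  exists2 d : R, 0 < d & forall y : R, K y -> `|y - x| <= d -> `|g y - g x| <= e.

Section OnCompact.
Variables (K : set R) (M : R).
Hypothesis KM : forall x : R, K x -> `|x| <= M.
Hypothesis Kclosed : forall a : R,
  (forall e : R, 0 < e -> exists2 b : R, K b & `|b - a| <= e) -> K a.

Lemma compact_cluster (u : nat -> R) : (forall n, K (u n)) ->
  exists2 x : R, K x & forall (e : R) (N : nat), 0 < e -> exists2 n, (N <= n)%N & `|u n - x| <= e.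
Proof.
move=> hu; have [|f fi /cvg_ex[x /cvgrPdist_le hx]] := @bolzano_weierstrass _ u.
  exists M; split; first exact: num_real.
  by move=> y My n _ /=; apply: le_trans (KM (hu n)) (ltW My).
have h (e : R) N : 0 < e -> exists2 n, (N <= n)%N & `|u n - x| <= e.
  move=> /hx[n0 _ hn]; exists (f (maxn N n0)).
    apply: leq_trans (leq_maxl N n0) _; elim: (maxn N n0) => // n IH.
    by apply: leq_ltn_trans IH _; rewrite ltnNge -leEnat fi -ltnNge.
  by rewrite distrC; apply: (hn (maxn N n0)); rewrite /= leq_maxr.
exists x => //; apply: Kclosed => e e0; have [n _ hn] := h e 0%N e0.
by exists (u n).
Qed.

Lemma cont_on_bounded g : cont_on K g -> exists2 F : R, 0 < F & forall x : R, K x -> `|g x| <= F.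
Proof.
move=> cg; apply: contrapT => hF.
have /choice[u hu] n : exists x : R, K x /\ n%:R < `|g x|.
  apply: contrapT => h; apply: hF; exists (n%:R + 1); first by rewrite ltr_wpDl.
  move=> x Kx; rewrite leNgt; apply/negP => h'; apply: h; exists x; split=> //; lra.
have [x Kx hx] := compact_cluster (fun n => (hu n).1).
have [d d0 hd] := cg x Kx 1 ltr01.
have [N hN] : exists N : nat, `|g x| + 1 < N%:R by exact: natr_gt.
have [n Nn un] := hx d N d0; have := hd _ (hu n).1 un.
have := (hu n).2; have : N%:R <= n%:R :> R by rewrite ler_nat.
by have := ler_normD (g (u n) - g x) (g x); rewrite subrK; lra.
Qed.

(** Uniform continuity in the form that the regularization below needs. As [|g| <= F], pairs
    violating the bound for [L = n + 1] are at distance at most [2 F / (n + 1)]; both members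
    approach a common cluster point, where continuity fails. *)
Lemma cont_on_almost_lipschitz g e : cont_on K g -> 0 < e ->
  exists2 L : R, 0 < L & forall x y, K x -> K y -> `|g x - g y| <= e + L * `|x - y|.
Proof.
move=> cg e0; have [F F0 hF] := cont_on_bounded cg.
apply: contrapT => hL.
have /choice[u hu] (n : nat) : exists xy : R * R, [/\ K xy.1, K xy.2 &
    e + (n%:R + 1) * `|xy.1 - xy.2| < `|g xy.1 - g xy.2|].
  apply: contrapT => h; apply: hL; exists (n%:R + 1); first by rewrite ltr_wpDl.
  move=> x y Kx Ky; rewrite leNgt; apply/negP => h'; apply: h.
  by exists (x, y).
have [x Kx hx] := @compact_cluster (fun n => (u n).1) (fun n => let: And3 h _ _ := hu n in h).
have e2 : 0 < e / 2 by lra.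
have [d d0 hd] := cg x Kx _ e2; have d2 : 0 < d / 2 by lra.
have [N hN] : exists N : nat, 4 * F / d < N%:R.
  exact: natr_gt.
have [n Nn un] := hx (d / 2) N d2; have [K1 K2 h] := hu n.
have Nn' : N%:R <= n%:R :> R by rewrite ler_nat.
have := hF _ K1; have := hF _ K2; have := ler_normB (g (u n).1) (g (u n).2).
move=> h1 h2 h3; have xy : `|(u n).1 - (u n).2| <= d / 2.
  rewrite leNgt; apply/negP => hxy.
  have : (4 * F / d) * (d / 2) < (n%:R + 1) * `|(u n).1 - (u n).2|.
    have Fd : 0 <= 4 * F / d by rewrite ltW // divr_gt0 // mulr_gt0.
    by apply: ltr_pM => //; [exact: ltW | apply: lt_le_trans hN _; rewrite ler_wpDr].
  have -> : 4 * F / d * (d / 2) = 2 * F by field; rewrite gt_eqF.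
  lra.
have a1 : `|(u n).1 - x| <= d by lra.
have a2 : `|(u n).2 - x| <= d.
  have := ler_distD (u n).1 (u n).2 x; rewrite (distrC (u n).2 (u n).1); lra.
have := hd _ K1 a1; have := hd _ K2 a2.
have := ler_distD (g x) (g (u n).1) (g (u n).2); rewrite (distrC (g x)).
have : 0 <= (n%:R + 1) * `|(u n).1 - (u n).2| by rewrite mulr_ge0.
lra.
Qed.

Lemma weierstrass g e : cont_on K g -> 0 < e ->
  exists p : {poly R}, forall x : R, K x -> `|p.[x] - g x| <= e.
Proof.
move=> cg e0; have e2 : 0 < e / 2 by lra.
have [F F0 hF] := cont_on_bounded cg.
have [L L0 hL] := cont_on_almost_lipschitz cg e2.
have [[k0 Kk0]|K0] := pselect (exists x : R, K x); last by exists 0 => x Kx; case: K0; exists x.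
have M0 : 0 < `|M| + 1 by rewrite ltr_wpDl.
(* [h] is the infimal convolution of [g] with [L |x|]: it is defined on the whole line, is
   [L]-Lipschitz, and lies between [g - e / 2] and [g] on [K]. *)
pose V (x : R) := [set g k + L * `|x - k| | k in K]; pose h (x : R) := inf (V x).
have V0 x : V x !=set0 by exists (g k0 + L * `|x - k0|); exists k0.
have Vlb x : has_lbound (V x).
  exists (- F) => _ [k Kk <-]; have := hF k Kk; rewrite ler_norml => /andP[hk _].
  by apply: le_trans hk _; rewrite lerDl mulr_ge0 // ltW.
have hle (x y : R) : h x <= h y + L * `|x - y|.
  rewrite -lerBlDr; apply: lb_le_inf => // _ [k Kk <-].
  rewrite lerBlDr; apply: le_trans (ge_inf (Vlb x) (ex_intro2 _ _ k Kk erefl)) _.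
  rewrite -addrA -mulrDr lerD2l ler_pM2l // [X in _ <= X]addrC; exact: ler_distD.
have lip (x y : R) : `|h x - h y| <= L * `|x - y|.
  rewrite ler_norml lerBrDl lerBlDl addrC lerBlDr -!lerBlDl.
  by have := hle x y; have := hle y x; rewrite (distrC y); lra.
have [p hp] := lipschitz_approx lip M0 e2; exists p => x Kx.
have := hp x (le_trans (KM Kx) (le_trans (ler_norm M) (ltW (ltr_pwDr ltr01 (lexx _))))).
have h1 : h x <= g x.
  by have := ge_inf (Vlb x) (ex_intro2 _ _ x Kx erefl); rewrite subrr normr0 mulr0 addr0.
have h2 : g x - e / 2 <= h x.
  apply: lb_le_inf => // _ [k Kk <-]; have := hL x k Kx Kk; rewrite ler_norml => /andP[_]; lra.
by rewrite !ler_norml => /andP[h3 h4]; apply/andP; split; lra.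
Qed.
End OnCompact.
End Bernstein.

(** * Existence of the continuous functional calculus *)

Section ComplexContinuity.
Variable R : realType.
Local Notation C := (cplx R).

Lemma complex_cvgP (F : set_system C) (l : C) : Filter F ->
  F --> l <-> forall e : R, 0 < e -> \forall w \near F, cabs (w - l) <= e.
Proof.
move=> FF; split.
  move=> /cvgrPdist_le h e e0; have := h e%:C; rewrite ltcR => /(_ e0).
  by apply: filterS => w; rewrite -normrN opprB cabsE lecR.
move=> h; apply/cvgrPdist_le => e e0.
have eE : e = (Re e)%:C by rewrite RRe_real // realE ltW.
have e0' : 0 < Re e by move: e0; rewrite {1}eE ltcR.
by apply: filterS (h _ e0') => w; rewrite eE -normrN opprB cabsE lecR.
Qed.

Lemma near_cabs (z : C) (e : R) : 0 < e -> \forall w \near z, cabs (w - z) <= e.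
Proof.
move=> e0; have /complex_cvgP/(_ e e0) : nbhs z --> z by exact: cvg_id.
exact.
Qed.

Lemma conjB (z w : C) : Num.conj (z - w) = Num.conj z - Num.conj w.
Proof. exact: rmorphB. Qed.

Lemma continuous_Re : continuous (fun z : C => Re z).
Proof.
move=> z; have FF : Filter (nbhs z) := nbhs_filter z.
apply/cvgrPdist_le => e e0.
near=> w; rewrite distrC -cReN -cReD; apply: le_trans (Re_le_cabs _) _.
by near: w; exact: near_cabs.
Unshelve. all: by end_near.
Qed.
Lemma continuous_complex : continuous (fun a : R => a%:C : C).
Proof.
move=> a; apply/complex_cvgP => e e0 /=.
have /cvgrPdist_le/(_ e e0) : id @ a --> a by [].
by apply: filterS => w /=; rewrite -raddfB cabsR distrC.
Qed.
Lemma continuous_conj : continuous (fun z : C => Num.conj z).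
Proof.
move=> z; have FF : Filter (nbhs z) := nbhs_filter z.
apply/complex_cvgP => e e0; rewrite near_map.
near=> w; rewrite -conjB cabsJ.
by near: w; exact: near_cabs.
Unshelve. all: by end_near.
Qed.
End ComplexContinuity.

Section ContinuousOnSpectrum.
Variables (R : realType) (H : completeNormedModType (cplx R)).
Local Notation C := (cplx R).
Variable (B : H -> H).
Implicit Types (f g : C -> C) (h : C -> R).
Local Notation cts := (continuous_on_spectrum B).

Lemma cts_cst (a : C) : cts (fun=> a).
Proof. by move=> z; exact: cvg_cst. Qed.
Lemma cts_continuous f : continuous f -> cts f.
Proof. exact: continuous_subspaceT. Qed.
Lemma ctsD f g : cts f -> cts g -> cts (f \+ g).
Proof.
move=> /subspace_continuousP cf /subspace_continuousP cg.
by apply/subspace_continuousP => z sz; apply: cvgD; [exact: cf|exact: cg].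
Qed.
Lemma ctsM f g : cts f -> cts g -> cts (f \* g).
Proof.
move=> /subspace_continuousP cf /subspace_continuousP cg.
by apply/subspace_continuousP => z sz; apply: cvgM; [exact: cf|exact: cg].
Qed.
Lemma cts_comp (k : C -> C) f : continuous k -> cts f -> cts (k \o f).
Proof.
move=> ck /subspace_continuousP cf; apply/subspace_continuousP => z sz.
by apply: (cvg_comp _ _ (cf z sz)); exact: ck.
Qed.
Lemma cts_conj f : cts f -> cts (fun z => Num.conj (f z)).
Proof. exact: (cts_comp (@continuous_conj R)). Qed.
Lemma cts_scale (a : C) f : cts f -> cts (fun z => a * f z).
Proof.
move=> /subspace_continuousP cf; apply/subspace_continuousP => z sz.
by apply: cvgM; [exact: cvg_cst|exact: cf].
Qed.
Lemma cts_real (k : R -> R) f : continuous k -> cts f ->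
  cts (fun z => (k (Re (f z)))%:C).
Proof.
move=> ck /subspace_continuousP cf; apply/subspace_continuousP => z sz.
have h1 := cvg_comp _ _ (cf z sz) (@continuous_Re R (f z)).
have h2 := cvg_comp _ _ h1 (ck (Re (f z))).
exact: (cvg_comp _ _ h2 (@continuous_complex R (k (Re (f z))))).
Qed.

Lemma ctsP f : cts f <-> forall z, spectrum B z -> forall e : R, 0 < e ->
  exists2 d : R, 0 < d & forall w, spectrum B w -> cabs (w - z) <= d ->
    cabs (f w - f z) <= e.
Proof.
rewrite /continuous_on_spectrum subspace_continuousP; split=> [h z sz e e0|h z sz].
  have /complex_cvgP/(_ e e0) := h z sz; rewrite near_map near_withinE => /nbhs_ballP[d d0 hd].
  have dE : d = (Re d)%:C by rewrite RRe_real // realE ltW.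
  have d0' : 0 < Re d by move: d0; rewrite {1}dE /= ltcR.
  exists (Re d / 2); first lra.
  move=> w sw wz; apply: hd => //; rewrite -ball_normE /= dE -normrN opprB cabsE ltcR.
  by apply: le_lt_trans wz _; lra.
apply/complex_cvgP => e e0; have [d d0 hd] := h z sz e e0.
rewrite near_map near_withinE; by apply: filterS (near_cabs z d0) => w wz sw; apply: hd.
Qed.
End ContinuousOnSpectrum.

(** * Construction of the calculus by polynomial approximation *)

Section Calculus.
Variables (R : realType) (H : completeNormedModType (cplx R)).
Local Notation C := (cplx R).
Variable dot : {dot H for @Num.conj C}.
Hypothesis hdot : dot_norm dot.
Variable B : H -> H.
Hypotheses (bB : bounded_operator B) (sB : self_adjoint dot B).
Implicit Types (f g : C -> C) (p q : {poly C}) (x y : H).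
Local Notation cts := (continuous_on_spectrum B).

Definition uniformly_close (e : R) p f :=
  forall z, spectrum B z -> cabs (p.[z] - f z) <= e.

Lemma real_poly_approx (k : C -> R) (e : R) : cts (fun z => (k z)%:C) -> 0 < e ->
  exists p, uniformly_close e p (fun z => (k z)%:C).
Proof.
move=> /ctsP ck e0.
pose K : set R := [set a | spectrum B a%:C].
have [M M0 hM] := spectrum_bounded hdot bB sB.
have KM a : K a -> `|a| <= M by move/hM.
have Kc := @spectrum_closed _ _ _ hdot _ bB sB.
have cK : cont_on K (fun a => k a%:C).
  move=> a Ka d d0; have [d' d'0 hd'] := ck _ Ka _ d0; exists d' => // b Kb ba.
  by have := hd' _ Kb; rewrite -!rmorphB !cabsR; apply.
have [p hp] := weierstrass KM Kc cK e0.
exists (map_poly (real_complex R) p) => z sz; rewrite (spectrumE hdot bB sB sz).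
rewrite horner_map -rmorphB cabsR; apply: hp.
by rewrite /K /= -(spectrumE hdot bB sB sz).
Qed.

Lemma poly_approx f (e : R) : cts f -> 0 < e -> exists p, uniformly_close e p f.
Proof.
move=> cf e0; have e2 : 0 < e / 2 by lra.
have cid : continuous (@id R) by move=> a; exact: cvg_id.
have cRe : cts (fun z => (Re (f z))%:C) by apply: (cts_real cid).
have cIm : cts (fun z => (Im (f z))%:C).
  have -> : (fun z => (Im (f z))%:C : C) = fun z => (Re (- 'i * f z))%:C.
    by apply: funext => z; rewrite cReM /=; congr (_%:C); ring.
  by apply: (cts_real cid); apply: cts_scale.
have [p hp] := real_poly_approx cRe e2; have [q hq] := real_poly_approx cIm e2.
exists (p + 'i%C *: q) => z sz; rewrite hornerD hornerZ.
have -> : p.[z] + 'i%C * q.[z] - f z =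
    (p.[z] - (Re (f z))%:C) + 'i%C * (q.[z] - (Im (f z))%:C).
  by rewrite mulrBr addrACA -opprD -complexE.
apply: le_trans (cabsD _ _) _; rewrite cabsM.
have -> : cabs ('i%C : C) = 1.
  by apply/eqP; rewrite -(eqrXn2 (n := 2)) ?cabs_ge0 // cabs2 /= expr0n add0r.
by have := hp z sz; have := hq z sz; lra.
Qed.

Lemma poly_bounded p : exists2 M : R, 0 < M & forall z, spectrum B z -> cabs p.[z] <= M.
Proof.
have [N N0 hN] := spectrum_bounded hdot bB sB.
elim/poly_ind: p => [|p c [M M0 hM]].
  by exists 1 => // z _; rewrite horner0 /cabs normr0.
exists (M * N + cabs c + 1) => [|z sz].
  by rewrite ltr_wpDl // addr_ge0 ?cabs_ge0 // mulr_ge0 ?ltW.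
rewrite hornerD hornerMX hornerC; apply: le_trans (cabsD _ _) _.
rewrite cabsM {2}(spectrumE hdot bB sB sz) cabsR.
have : cabs p.[z] * `|Re z| <= M * N by rewrite ler_pM ?cabs_ge0 ?hM ?hN.
lra.
Qed.

Lemma cts_bounded f : cts f ->
  exists2 M : R, 0 < M & forall z, spectrum B z -> cabs (f z) <= M.
Proof.
move=> cf; have [p hp] := poly_approx cf ltr01; have [M M0 hM] := poly_bounded p.
exists (M + 1); first by rewrite addr_gt0.
move=> z sz; have := cabsD (p.[z]) (- (p.[z] - f z)).
by rewrite opprB addrC subrK -opprB cabsN; have := hp z sz; have := hM z sz; lra.
Qed.

(** The limit of the [p(B) x] for [p] tending to [f] uniformly on the spectrum. Asking for the error
    bound for all [p] at once makes it independent of an approximating sequence. *)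
Definition calculus_value f x : set H := [set y | forall (e : R) p, 0 <= e ->
  uniformly_close e p f -> rn (pev B p x - y) <= e * rn x].

Definition calculus f x : H := xget 0 (calculus_value f x).

Lemma pev_close (e d : R) p q f x : 0 <= e -> 0 <= d -> uniformly_close e p f ->
  uniformly_close d q f -> rn (pev B p x - pev B q x) <= (e + d) * rn x.
Proof.
move=> e0 d0 hp hq; have -> : pev B p x - pev B q x = pev B (p - q) x.
  by rewrite -[- q]scaleN1r pevD // pevZ scaleN1r.
apply: (pev_norm_le hdot bB sB); first exact: addr_ge0.
move=> z sz; have := hp z sz; have := hq z sz.
have := cabsD (p.[z] - f z) (- (q.[z] - f z)).
by rewrite cabsN hornerD hornerN opprB addrA subrK; lra.
Qed.

Lemma calculusP f x : cts f -> calculus_value f x (calculus f x).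
Proof.
move=> cf; suff [y hy] : exists y, calculus_value f x y by apply: xgetPex; exists y.
have i0 n : 0 < n.+1%:R^-1 :> R by rewrite invr_gt0 ltr0Sn.
have /choice[p hp] n := poly_approx cf (i0 n).
have small (d : R) : 0 < d -> exists N : nat, forall n, (N <= n)%N -> n.+1%:R^-1 * rn x <= d.
  move=> d0; have [N hN] := natr_gt (rn x / d); exists N => n Nn.
  rewrite ler_pdivrMl ?ltr0Sn // -ler_pdivrMr //; apply: le_trans (ltW hN) _.
  by rewrite ler_nat ltnW.
have [y hy] : exists y, tends (fun n => pev B (p n) x) y.
  apply: cauchy_tends => d d0; have d2 : 0 < d / 2 by lra.
  have [N hN] := small _ d2; exists N => m n Nm Nn.
  have := pev_close x (ltW (i0 m)) (ltW (i0 n)) (hp m) (hp n); rewrite mulrDl.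
  by move=> /le_trans; apply; rewrite (splitr d); apply: lerD; apply: hN.
exists y => e q e0 hq; rewrite rnBC; apply/ler_addgt0Pr => d d0.
apply: tends_le hy _; have [N hN] := small _ d0; exists N => n Nn.
apply: le_trans (pev_close x (ltW (i0 n)) e0 (hp n) hq) _.
by rewrite mulrDl addrC lerD2l hN.
Qed.

(** The criterion behind the algebraic laws of the calculus: a single well-chosen polynomial for
    each precision identifies the value. *)
Lemma calculus_unique f x y (c : R) : cts f ->
  (forall e : R, 0 < e -> exists2 p, uniformly_close e p f & rn (pev B p x - y) <= e * c) ->
  calculus f x = y.
Proof.
move=> cf h; apply/eqP; rewrite -subr_eq0; apply/eqP/rn_small => e e0.
have c0 : 0 < rn x + `|c| + 1 by rewrite ltr_wpDl // addr_ge0 // rn_ge0.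
have d0 : 0 < e / (rn x + `|c| + 1) by rewrite divr_gt0.
have [p hp py] := h _ d0; have := calculusP x cf (ltW d0) hp.
have := rnD3 (pev B p x) (calculus f x) y; rewrite (rnBC (calculus f x) (pev B p x)).
move: d0 py; set d := e / _ => d0 py.
have : d * c <= d * `|c| by rewrite ler_pM2l // ler_norm.
have : d * (rn x + `|c| + 1) = e by rewrite divfK // gt_eqF.
nra.
Qed.

(** The zero polynomial approximates [f] within [M]. *)
Lemma calculus_norm f x (M : R) : cts f -> 0 <= M ->
  (forall z, spectrum B z -> cabs (f z) <= M) -> rn (calculus f x) <= M * rn x.
Proof.
move=> cf M0 hM; have := calculusP x cf M0 (p := 0) _.
rewrite -(@polyC0 C) pevC scale0r sub0r rnN; apply=> z sz.
by rewrite hornerC sub0r cabsN hM.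
Qed.

Lemma calculus_linear f : cts f -> linear (calculus f).
Proof.
move=> cf a x y; apply: (calculus_unique (c := cabs a * rn x + rn y)) => // e e0.
have [p hp] := poly_approx cf e0; exists p => //.
have lp := bop_lin (bop_pev bB p); rewrite lp opprD addrACA -scalerBr.
apply: le_trans (rnD _ _) _; rewrite rnZ mulrDr mulrCA.
have h z : rn (pev B p z - calculus f z) <= e * rn z.
  exact: (calculusP z cf (ltW e0) hp).
by apply: lerD; [apply: ler_wpM2l; [exact: cabs_ge0|]|]; apply: h.
Qed.

Lemma calculus_is_cfc : is_cfc dot B calculus.
Proof.
split.
- move=> f cf; have [M M0 hM] := cts_bounded cf.
  apply: (bop_intro (M := M)); first exact: calculus_linear.
  by move=> x; apply: calculus_norm => //; exact: ltW.
- move=> f g cf cg fg; apply: funext => x; congr (xget _ _); apply/seteqP.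
  by split=> y h e p e0 hp; apply: h => // z sz; have := hp z sz; rewrite fg.
- apply: funext => x; apply: (calculus_unique (c := 0)); first exact: cts_cst.
  move=> e e0; exists 1 => [z sz|].
    by rewrite hornerC subrr /cabs normr0 ltW.
  by rewrite pevC scale1r subrr rn0 mulr0.
- apply: funext => x; apply: (calculus_unique (c := 0)).
    by apply: cts_continuous => z; exact: cvg_id.
  move=> e e0; exists 'X => [z sz|].
    by rewrite hornerX subrr /cabs normr0 ltW.
  by rewrite pevX // subrr rn0 mulr0.
- move=> f g cf cg; apply: funext => x /=.
  apply: (calculus_unique (c := rn x)); first exact: ctsD.
  move=> e e0; have e2 : 0 < e / 2 by lra.
  have [p hp] := poly_approx cf e2; have [q hq] := poly_approx cg e2.
  exists (p + q) => [z sz|].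
    rewrite hornerD /= opprD addrACA; have := cabsD (p.[z] - f z) (q.[z] - g z).
    by have := hp z sz; have := hq z sz; lra.
  rewrite pevD // opprD addrACA; apply: le_trans (rnD _ _) _.
  have := calculusP x cf (ltW e2) hp.
  by have := calculusP x cg (ltW e2) hq; lra.
- move=> a f cf; apply: funext => x /=.
  apply: (calculus_unique (c := rn x)); first exact: cts_scale.
  move=> e e0; have a1 : 0 < cabs a + 1 by rewrite ltr_wpDl ?cabs_ge0.
  have d0 : 0 < e / (cabs a + 1) by rewrite divr_gt0.
  have le_e : cabs a * (e / (cabs a + 1)) <= e.
    by rewrite mulrCA -[X in _ <= X]mulr1 ler_pM2l // ler_pdivrMr // mul1r; lra.
  have [p hp] := poly_approx cf d0; exists (a *: p) => [z sz|].
    rewrite hornerZ -mulrBr cabsM; apply: le_trans le_e.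
    by rewrite ler_wpM2l ?cabs_ge0 // hp.
  rewrite pevZ -scalerBr rnZ; apply: le_trans (_ : cabs a * (e / (cabs a + 1) * rn x) <= _).
    by have h := calculusP x cf (ltW d0) hp; rewrite ler_wpM2l ?cabs_ge0.
  by rewrite mulrA ler_wpM2r ?rn_ge0.
- move=> f g cf cg; apply: funext => x /=.
  apply: (calculus_unique (c := 2 * rn x)); first exact: ctsM.
  move=> e e0; have e2 : 0 < e / 2 by lra.
  (* The order of the choices matters: [p] has its error divided by the bound [G] of [g], then [q]
     has its error divided by the bound [P] of this [p]. *)
  have [G G0 hG] := cts_bounded cg.
  have [p hp] := poly_approx cf (divr_gt0 e2 G0).
  have [P P0 hP] := poly_bounded p.
  have [q hq] := poly_approx cg (divr_gt0 e2 P0).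
  exists (p * q) => [z sz|].
    have -> : (p * q).[z] - f z * g z = p.[z] * (q.[z] - g z) + (p.[z] - f z) * g z.
      by rewrite hornerM; ring.
    apply: le_trans (cabsD _ _) _; rewrite !cabsM.
    have : cabs p.[z] * cabs (q.[z] - g z) <= e / 2.
      have -> : e / 2 = P * (e / 2 / P) by rewrite [RHS]mulrC divfK // gt_eqF.
      by rewrite ler_pM ?cabs_ge0 ?hP ?hq.
    have : cabs (p.[z] - f z) * cabs (g z) <= e / 2.
      have -> : e / 2 = e / 2 / G * G by rewrite divfK // gt_eqF.
      by rewrite ler_pM ?cabs_ge0 ?hG ?hp.
    lra.
  rewrite pevM //; apply: le_trans (rnD3 (pev B p (calculus g x)) _ _) _.
  have lp := bop_lin (bop_pev bB p); rewrite -(linB _ _ lp).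
  have := pev_norm_le hdot bB sB (ltW P0) hP (pev B q x - calculus g x).
  have h1 := calculusP x cg (ltW (divr_gt0 e2 P0)) hq.
  have := calculusP (calculus g x) cf (ltW (divr_gt0 e2 G0)) hp.
  have h2 := calculus_norm x cg (ltW G0) hG.
  have h3 : P * rn (pev B q x - calculus g x) <= e / 2 * rn x.
    apply: le_trans (ler_wpM2l (ltW P0) h1) _.
    by rewrite mulrA [P * _]mulrC divfK // gt_eqF.
  have h4 : e / 2 / G * rn (calculus g x) <= e / 2 * rn x.
    apply: le_trans (ler_wpM2l (ltW (divr_gt0 e2 G0)) h2) _.
    by rewrite mulrA divfK // gt_eqF.
  have : 0 <= e * rn x by rewrite mulr_ge0 ?rn_ge0 ?ltW.
  lra.
- move=> f cf x y; set f' := fun z => Num.conj (f z).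
  have cf' : cts f' by apply: cts_conj.
  apply/eqP; rewrite -subr_eq0; apply/eqP/cabs_eq0/eqP.
  rewrite eq_le cabs_ge0 andbT; apply/ler_addgt0Pr => e e0; rewrite add0r.
  have c0 : 0 < 2 * (rn x * rn y) + 1 by rewrite ltr_wpDl // !mulr_ge0 ?rn_ge0.
  have d0 : 0 < e / (2 * (rn x * rn y) + 1) by rewrite divr_gt0.
  have [p hp] := poly_approx cf d0.
  (* Since the spectrum is real, conjugating the coefficients of [p] conjugates its values there. *)
  have hp' : uniformly_close (e / (2 * (rn x * rn y) + 1)) (map_poly Num.conj p) f'.
    move=> z sz; have {1}-> : z = Num.conj z.
      by apply: complex_eq; rewrite ?cReJ // cImJ (spectrum_real hdot bB sB sz) oppr0.
    by rewrite horner_map -conjB cabsJ hp.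
  have -> : dot (calculus f x) y - dot x (calculus f' y) =
      dot x (pev B (map_poly Num.conj p) y - calculus f' y) -
      dot (pev B p x - calculus f x) y.
    rewrite dotDr dotDl dotNr dotNl (adj_pev bB sB); ring.
  apply: le_trans (cabsD _ _) _; rewrite cabsN.
  have := cabs_dot hdot x (pev B (map_poly Num.conj p) y - calculus f' y).
  have := cabs_dot hdot (pev B p x - calculus f x) y.
  have h1 := calculusP x cf (ltW d0) hp.
  have h2 := calculusP y cf' (ltW d0) hp'.
  have h3 := ler_wpM2r (rn_ge0 y) h1; have h4 := ler_wpM2l (rn_ge0 x) h2.
  move: d0 h3 h4; set d := e / _ => d0 h3 h4.
  have : d * (2 * (rn x * rn y) + 1) = e by rewrite divfK // gt_eqF.
  nra.
Qed.

Lemma cfcP : is_cfc dot B (cfc dot B).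
Proof. by apply: xgetPex; exists calculus; exact: calculus_is_cfc. Qed.
End Calculus.

(** * Consequences of the functional calculus *)

Section CalculusConsequences.
Variables (R : realType) (H : completeNormedModType (cplx R)).
Local Notation C := (cplx R).
Variable dot : {dot H for @Num.conj C}.
Hypothesis hdot : dot_norm dot.
Local Notation rd := (redot dot).

(** Polarization: the defect [h] vanishes on the diagonal, and its values at [x + y] and [x + i y]
    give [h x y + h y x = 0] and [h x y = h y x]. *)
Lemma positive_self_adjoint (T : H -> H) : linear T -> positive_operator dot T ->
  self_adjoint dot T.
Proof.
move=> lT pT x y; pose h x y := dot (T x) y - dot x (T y).
have hxx z : h z z = 0.
  have := pT z; rewrite lecE => /andP[/eqP /= im0 _].
  rewrite /h (dotC dot z); apply: complex_eq; rewrite ?(cReD, cImD, cReN, cImN, cReJ, cImJ) ?im0 /=;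
    lra.
have hD u v : h (u + v) (u + v) = h u u + h v v + (h u v + h v u).
  by rewrite /h (linD _ _ lT) !dotDl !dotDr; ring.
have hi : h x ('i%C *: y) = - 'i%C * h x y.
  by rewrite /h (linZ _ _ lT) !dotZr mulrBr; congr (_ * _ - _ * _); apply: complex_eq => /=; lra.
have hi' : h ('i%C *: y) x = 'i%C * h y x.
  by rewrite /h (linZ _ _ lT) !dotZl mulrBr.
have := hD x ('i%C *: y); rewrite !hxx !add0r hi hi'.
have := hD x y; rewrite !hxx !add0r => e1 e2.
apply/eqP; rewrite -subr_eq0 -/(h x y); apply/eqP.
move: e1 e2; move: (h x y) (h y x) => [a b] [c d] /eqP e1 /eqP e2.
move: e1 e2; rewrite !eq_complex /= => /andP[/eqP e1 /eqP e2] /andP[/eqP e3 /eqP e4].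
by apply: complex_eq => /=; lra.
Qed.

Variable B : H -> H.
Hypotheses (bB : bounded_operator B) (sB : self_adjoint dot B).
Local Notation cts := (continuous_on_spectrum B).
Local Notation fc := (cfc dot B).
Implicit Types (f g : C -> C).

Let isf := cfcP hdot bB sB.

Lemma fc_linear f : cts f -> linear (fc f).
Proof. by move=> cf; case: (cfc_bounded isf cf). Qed.

Lemma fc_sub_cst f (a : C) x : cts f -> fc (fun z => f z - a) x = fc f x - a *: x.
Proof.
move=> cf; have c1 := @cts_cst _ _ B (1 : C); have ca := cts_scale (a := - a) c1.
have -> : (fun z => f z - a) = f \+ (fun z => - a * 1).
  by apply: funext => z /=; rewrite mulr1.
by rewrite (cfc_add isf cf ca) /= (cfc_scale isf _ c1) (cfc_one isf) /= scaleNr.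
Qed.

Lemma cts_id : cts id.
Proof. by apply: cts_continuous => z; exact: cvg_id. Qed.

Lemma fc_id_sub_cst (a : C) x : fc (fun z => z - a) x = B x - a *: x.
Proof. by rewrite (fc_sub_cst a x cts_id) (cfc_id isf). Qed.

Lemma cts_abs2 f : cts f -> cts (fun z => Num.conj (f z) * f z).
Proof. by move=> cf; apply: (ctsM (cts_conj cf) cf). Qed.

Lemma fc_mul f g x : cts f -> cts g -> fc (fun z => f z * g z) x = fc f (fc g x).
Proof. by move=> cf cg; have /(congr1 (@^~ x)) := cfc_mul isf cf cg. Qed.

Lemma fc_norm2 f x : cts f ->
  rn (fc f x) ^+ 2 = rd (fc (fun z => Num.conj (f z) * f z) x) x.
Proof.
move=> cf; rewrite (fc_mul x (cts_conj cf) cf) rdC.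
by rewrite -(rd_adj _ _ (cfc_conj isf cf)) (rdxx hdot).
Qed.

(* On the spectrum |g|^2 = |f|^2 + h^2 for the continuous h = (|g|^2 - |f|^2)^(1/2). *)
Lemma fc_le f g x : cts f -> cts g ->
  (forall z, spectrum B z -> cabs (f z) <= cabs (g z)) -> rn (fc f x) <= rn (fc g x).
Proof.
move=> cf cg fg; have cf2 := cts_abs2 cf; have cg2 := cts_abs2 cg.
pose d z := Num.conj (g z) * g z + -1 * (Num.conj (f z) * f z).
have cd : cts d by apply: (ctsD cg2 (cts_scale (a := -1) cf2)).
pose h z : C := (Num.sqrt (Re (d z)))%:C.
have ch : cts h by apply: (cts_real (@sqrt_continuous R)).
have ch2 := cts_abs2 ch.
have dE z : Re (d z) = cabs (g z) ^+ 2 - cabs (f z) ^+ 2.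
  by rewrite /d cReD mulN1r cReN ![Num.conj _ * _]mulrC !mulJ.
have : fc (fun z => Num.conj (g z) * g z) =
    fc (fun z => Num.conj (f z) * f z) \+ fc (fun z => Num.conj (h z) * h z).
  rewrite -(cfc_add isf cf2 ch2); apply: (cfc_ext isf); [exact: cg2|exact: (ctsD cf2 ch2)|].
  move=> z sz /=; rewrite ![Num.conj _ * _]mulrC !mulJ -rmorphD /= cabsR.
  rewrite ger0_norm ?sqrtr_ge0 // sqr_sqrtr dE; first by congr (_%:C); ring.
  by rewrite subr_ge0 ler_pXn2r ?nnegrE ?cabs_ge0 // fg.
move=> /(congr1 (fun T => rd (T x) x)) /=; rewrite rdDl -!fc_norm2 // => e.
by rewrite -(@ler_pXn2r _ 2) ?nnegrE ?rn_ge0 // e lerDl sqr_ge0.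
Qed.

Lemma positive_sqrt : positive_operator dot B ->
  exists r, [/\ bounded_operator r, self_adjoint dot r & forall x, r (r x) = B x].
Proof.
move=> pB; pose h z : C := (Num.sqrt (Re z))%:C.
have ch : cts h by apply: (cts_real (@sqrt_continuous R) cts_id).
exists (fc h); split; first exact: (cfc_bounded isf ch).
  have := cfc_conj isf ch; congr (adjoint_of _ _ (fc _)).
  by apply: funext => z; apply: complex_eq; rewrite ?cReJ ?cImJ //= oppr0.
have : fc h \o fc h = B.
  rewrite -(cfc_mul isf ch ch) -[RHS](cfc_id isf); apply: (cfc_ext isf).
  - exact: (ctsM ch ch).
  - exact: cts_id.
  move=> z sz /=; rewrite [RHS](spectrumE hdot bB sB sz) -rmorphM -expr2 sqr_sqrtr //.
  exact: (spectrum_nonneg hdot bB sB pB sz).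
by move=> e x; rewrite -[in RHS]e.
Qed.

Lemma lipschitz_cos (L : R) (f : C -> R) :
  (forall s t, spectrum B s -> spectrum B t -> `|f s - f t| <= L * cabs (s - t)) ->
  cts (fun z => (f z)%:C).
Proof.
move=> hf; apply/ctsP => z sz e e0; have L1 : 0 < `|L| + 1 by rewrite ltr_wpDl.
exists (e / (`|L| + 1)); first exact: divr_gt0.
move=> w sw wz; rewrite -rmorphB cabsR; apply: le_trans (hf _ _ sw sz) _.
move: wz; rewrite ler_pdivlMr // => wz; apply: le_trans wz.
by rewrite mulrC ler_wpM2l ?cabs_ge0 //; have := ler_norm L; lra.
Qed.

(* c extends f to the point m with the same Lipschitz constant. *)
Lemma lipschitz_cfc_shift (f : C -> R) (m : R) :
  (forall s t, spectrum B s -> spectrum B t -> `|f s - f t| <= cabs (s - t)) ->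
  exists c : R, forall x,
    rn (fc (fun z => (f z)%:C) x - c%:C *: x) <= rn (B x - m%:C *: x).
Proof.
move=> hf; have cf : cts (fun z => (f z)%:C).
  by apply: (lipschitz_cos (L := 1)) => s t ss st; rewrite mul1r; exact: hf.
suff [c hc] : exists c : R, forall z, spectrum B z -> `|f z - c| <= cabs (z - m%:C).
  exists c => x; rewrite -fc_sub_cst // -fc_id_sub_cst; apply: fc_le.
  - by have := ctsD cf (@cts_cst _ _ B (- c%:C)).
  - by have := ctsD cts_id (@cts_cst _ _ B (- m%:C : C)).
  by move=> z /hc; rewrite -rmorphB cabsR.
have [[s0 ss0]|none] := pselect (exists z, spectrum B z); last first.
  by exists 0 => z sz; case: none; exists z.
(* The supremum of this set is the value at [m] of the McShane extension of [f]. *)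
pose V := [set f s - cabs (s - m%:C) | s in spectrum B].
have ub z : spectrum B z -> ubound V (f z + cabs (z - m%:C)).
  move=> sz _ [s ss <-]; have := hf s z ss sz; rewrite ler_norml => /andP[_].
  have := cabsD (s - m%:C) (m%:C - z); rewrite addrA subrK -[cabs (m%:C - z)]cabsN opprB.
  lra.
exists (sup V) => z sz; rewrite ler_norml; apply/andP; split.
  have : sup V <= f z + cabs (z - m%:C).
    by apply: ge_sup; [exists (f s0 - cabs (s0 - m%:C)); exists s0|exact: ub].
  lra.
have : f z - cabs (z - m%:C) <= sup V.
  apply: ub_le_sup; first by exists (f s0 + cabs (s0 - m%:C)); exact: ub.
  by exists z.
lra.
Qed.
End CalculusConsequences.

(** * Orthonormal bases *)

Section Basis.
Variables (R : realType) (H : completeNormedModType (cplx R)).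
Local Notation C := (cplx R).
Variable dot : {dot H for @Num.conj C}.
Hypothesis hdot : dot_norm dot.
Local Notation rd := (redot dot).
Local Notation E := (onb dot).
Implicit Types (J K : {fset H}) (x y e f : H).

Lemma onbP : orthonormal_basis dot E.
Proof.
apply: xgetPex; have [F tF|A [oA mA]] := @Zorn_bigcup H (orthonormal_set dot).
  move=> tot e f [X FX Xe] [Y FY Yf].
  by have [XY|YX] := tot _ _ FX FY;
    [apply: (tF Y FY) => //; exact: XY|apply: (tF X FX) => //; exact: YX].
exists A; split=> // F oF AF; apply: contrapT => FA; apply: (mA F) => //.
by rewrite properEneq; split=> //; apply/eqP => h; apply: FA.
Qed.

Lemma dot_onb e f : e \in E -> f \in E -> dot e f = (e == f)%:R.
Proof. by rewrite !inE => Ee Ef; have [oE _] := onbP; exact: oE. Qed.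
Lemma rn_onb e : e \in E -> rn e = 1.
Proof.
move=> Ee; have := dotxx hdot e; rewrite dot_onb // eqxx => /(congr1 (@complex.Re R)) /= h.
by apply/eqP; rewrite -(eqrXn2 (n := 2)) ?rn_ge0 // expr1n -h.
Qed.

Lemma dot_suml I (s : seq I) (P : pred I) (F : I -> H) y :
  dot (\sum_(i <- s | P i) F i) y = \sum_(i <- s | P i) dot (F i) y.
Proof. exact: (big_morph (dot^~ y) (fun a b => dotDl dot a b y) (dot0l dot y)). Qed.
Lemma dot_sumr I (s : seq I) (P : pred I) (F : I -> H) y :
  dot y (\sum_(i <- s | P i) F i) = \sum_(i <- s | P i) dot y (F i).
Proof. exact: (big_morph (dot y) (fun a b => dotDr dot a b y) (dot0r dot y)). Qed.

(** [J] is any finite set of vectors, those outside [E] being skipped, so that the nets below have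
    the same index set as [summability.totally]. *)
Definition onb_proj J x : H := \sum_(e <- J | e \in E) dot x e *: e.

Local Notation pr := onb_proj.

Lemma dot_pr_onb J x f : f \in E -> dot (pr J x) f = if f \in J then dot x f else 0.
Proof.
move=> Ef; rewrite /pr dot_suml; case: ifPn => [fJ|fJ].
  rewrite big_mkcond (bigD1_seq f) ?fset_uniq //= Ef dotZl (dot_onb Ef Ef) eqxx mulr1.
  rewrite big1 ?addr0 // => e ef; case: ifP => // Ee.
  by rewrite dotZl (dot_onb Ee Ef) (negPf ef) mulr0.
rewrite big_seq_cond big1 // => e /andP[eJ Ee]; rewrite dotZl (dot_onb Ee Ef).
by case: eqP eJ fJ => [->->//|]; rewrite mulr0.
Qed.

Lemma dot_pr J x y : dot (pr J x) y = \sum_(e <- J | e \in E) dot x e * dot e y.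
Proof. by rewrite /pr dot_suml; apply: eq_bigr => e _; rewrite dotZl. Qed.

Lemma pr_sa J : self_adjoint dot (pr J).
Proof.
move=> x y; rewrite dot_pr /pr dot_sumr; apply: eq_bigr => e _.
by rewrite dotZr -dotC mulrC.
Qed.

Lemma pr_ortho J K x y : (J `<=` K)%fset -> dot (x - pr K x) (pr J y) = 0.
Proof.
move=> JK; rewrite /pr dot_sumr big_seq_cond big1 // => e /andP[eJ Ee].
rewrite dotZr dotDl dotNl dot_pr_onb // (fsubsetP JK _ eJ) subrr mulr0 //.
Qed.

Lemma pythagoras x y : dot x y = 0 -> rn (x + y) ^+ 2 = rn x ^+ 2 + rn y ^+ 2.
Proof. by move=> h; rewrite (rn2D hdot) /redot h mulr0 addr0. Qed.

Lemma pr_pythagoras J x : rn x ^+ 2 = rn (x - pr J x) ^+ 2 + rn (pr J x) ^+ 2.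
Proof. by rewrite -pythagoras ?subrK // pr_ortho ?fsubset_refl. Qed.

Lemma pr_monotone J K x : (J `<=` K)%fset ->
  rn (x - pr J x) ^+ 2 = rn (x - pr K x) ^+ 2 + rn (pr K x - pr J x) ^+ 2.
Proof.
move=> JK; rewrite -pythagoras ?addrA ?subrK //.
by rewrite dotDr dotNr !pr_ortho ?fsubset_refl // subrr.
Qed.

Lemma rn2_pr J x : rn (pr J x) ^+ 2 = \sum_(e <- J | e \in E) cabs (dot x e) ^+ 2.
Proof.
apply: (@complexI R); rewrite -(dotxx hdot) {2}/pr dot_sumr rmorph_sum /=.
rewrite big_seq_cond [RHS]big_seq_cond; apply: eq_bigr => e /andP[eJ Ee].
by rewrite dotZr dot_pr_onb // eJ mulrC mulJ.
Qed.

Lemma bessel J x : \sum_(e <- J | e \in E) cabs (dot x e) ^+ 2 <= rn x ^+ 2.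
Proof. by rewrite -rn2_pr (pr_pythagoras J x) lerDr sqr_ge0. Qed.

(* The residues along a minimizing sequence of finite sets are Cauchy; their
   limit is orthogonal to E, hence 0 by maximality of E. *)
Lemma onb_dense x (d : R) : 0 < d ->
  exists J, forall K, (J `<=` K)%fset -> rn (x - pr K x) <= d.
Proof.
move=> d0; suff [J hJ] : exists J, rn (x - pr J x) <= d.
  exists J => K JK; apply: le_trans hJ.
  by rewrite -(@ler_pXn2r _ 2) ?nnegrE ?rn_ge0 // (pr_monotone x JK) lerDl sqr_ge0.
pose V := [set rn (x - pr J x) ^+ 2 | J in [set: {fset H}]].
have V0 : V !=set0 by exists (rn (x - pr fset0 x) ^+ 2); exists fset0.
have lbV : lbound V 0 by move=> _ [J _ <-]; rewrite sqr_ge0.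
have hlbV : has_lbound V by exists 0.
have infV J : inf V <= rn (x - pr J x) ^+ 2 by apply: ge_inf => //; exists J.
have i0 n : 0 < n.+1%:R^-1 :> R by rewrite invr_gt0 ltr0Sn.
(* The slack is the square of [1 / (n + 1)] because Pythagoras turns a drop of squared residues into
   a squared distance. *)
have /choice[J hJ] (n : nat) : exists J, rn (x - pr J x) ^+ 2 <= inf V + n.+1%:R^-1 ^+ 2.
  have /(inf_adherent (exprn_gt0 2 (i0 n)))[_ [J _ <-] h] : has_inf V by split.
  by exists J; exact: ltW.
have close n K : (J n `<=` K)%fset -> rn ((x - pr (J n) x) - (x - pr K x)) <= n.+1%:R^-1.
  move=> JK; rewrite opprB addrC addrA subrK.
  rewrite -(@ler_pXn2r _ 2) ?nnegrE ?rn_ge0 ?(ltW (i0 n)) //.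
  have := hJ n; have := infV K; rewrite (pr_monotone x JK).
  by move: (_^-1 ^+ 2) => a; lra.
have small (e : R) : 0 < e -> exists N : nat, forall n, (N <= n)%N -> n.+1%:R^-1 <= e.
  move=> e0; have [N hN] := natr_gt e^-1; exists N => n Nn.
  rewrite -[e]invrK lef_pV2 ?posrE ?invr_gt0 ?ltr0Sn //; apply: le_trans (ltW hN) _.
  by rewrite ler_nat ltnW.
have [y hy] : exists y, tends (fun n => x - pr (J n) x) y.
  apply: cauchy_tends => e e0; have e2 : 0 < e / 2 by lra.
  have [N hN] := small _ e2; exists N => m n Nm Nn.
  apply: le_trans (rnD3 (x - pr (J m `|` J n)%fset x) _ _) _.
  rewrite (splitr e) [X in _ + X <= _]rnBC; apply: lerD.
    by apply: le_trans (close m _ (fsubsetUl _ _)) (hN _ Nm).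
  by apply: le_trans (close n _ (fsubsetUr _ _)) (hN _ Nn).
have ort e : e \in E -> dot y e = 0.
  move=> Ee; apply/cabs_eq0/eqP; rewrite eq_le cabs_ge0 andbT.
  apply/ler_addgt0Pr => c c0; rewrite add0r; have c2 : 0 < c / 2 by lra.
  have [N1 h1] := small _ c2; have [N2 h2] := hy _ c2; pose n := maxn N1 N2.
  pose K := (J n `|` [fset e])%fset.
  have z0 : dot (x - pr K x) e = 0.
    by rewrite dotDl dotNl dot_pr_onb // !inE eqxx orbT subrr.
  have -> : dot y e = dot (y - (x - pr K x)) e by rewrite dotDl dotNl z0 subr0.
  apply: le_trans (cabs_dot hdot _ _) _; rewrite (rn_onb Ee) mulr1.
  apply: le_trans (rnD3 (x - pr (J n) x) _ _) _; rewrite (splitr c); apply: lerD.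
    by rewrite rnBC h2 // leq_maxr.
  by apply: le_trans (close n K (fsubsetUl _ _)) (h1 _ _); rewrite leq_maxl.
have y0 : y = 0.
  apply: contrapT => /eqP y0; have yp := rn_gt0 y0.
  pose u := ((rn y)^-1)%:C *: y.
  have uu : dot u u = 1.
    by rewrite (dotxx hdot) /u rnZr ger0_norm ?invr_ge0 ?rn_ge0 // mulVf ?gt_eqF // expr1n.
  have uE e : e \in E -> dot u e = 0 by move=> Ee; rewrite /u dotZl ort // mulr0.
  have [oE mE] := onbP; have := mE (E `|` [set u]).
  have ou : orthonormal_set dot (E `|` [set u]).
    move=> e f [Ee|->] [Ef|->]; first exact: oE.
    - rewrite dotC uE ?inE // conjC0; case: eqP Ee => // -> /mem_set/uE.
      by rewrite uu => /eqP; rewrite oner_eq0.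
    - rewrite uE ?inE //; case: eqP Ef => // <- /mem_set/uE.
      by rewrite uu => /eqP; rewrite oner_eq0.
    - by rewrite eqxx uu.
  move=> /(_ ou (@subsetUl _ _ _)) h.
  have /mem_set/uE : E u by rewrite -h; right.
  by rewrite uu => /eqP; rewrite oner_eq0.
by have [N hN] := hy _ d0; exists (J N); have := hN N (leqnn N); rewrite y0 subr0.
Qed.

Definition nlim (G : {fset H} -> C) (l : C) := forall d : R, 0 < d ->
  exists J, forall K, (J `<=` K)%fset -> cabs (G K - l) <= d.

Lemma nlimD G G' l l' : nlim G l -> nlim G' l' -> nlim (fun K => G K + G' K) (l + l').
Proof.
move=> h h' d d0; have d2 : 0 < d / 2 by lra.
have [J hJ] := h _ d2; have [J' hJ'] := h' _ d2; exists (J `|` J')%fset => K.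
rewrite fsubUset => /andP[JK J'K]; rewrite opprD addrACA (splitr d).
by apply: le_trans (cabsD _ _) _; apply: lerD; [apply: hJ|apply: hJ'].
Qed.

Lemma nlimZ a G l : nlim G l -> nlim (fun K => a * G K) (a * l).
Proof.
move=> h d d0; have a1 : 0 < cabs a + 1 by rewrite ltr_wpDl ?cabs_ge0.
have [J hJ] := h _ (divr_gt0 d0 a1); exists J => K /hJ.
rewrite -mulrBr cabsM ler_pdivlMr // => hK; apply: le_trans hK.
by rewrite mulrC ler_wpM2l ?cabs_ge0 //; lra.
Qed.

Lemma nlim_sum I (s : seq I) (P : pred I) (G : I -> {fset H} -> C) (l : I -> C) :
  (forall i, nlim (G i) (l i)) ->
  nlim (fun K => \sum_(i <- s | P i) G i K) (\sum_(i <- s | P i) l i).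
Proof.
move=> h; elim: s => [|i s IH].
  by move=> d d0; exists fset0 => K _; rewrite !big_nil subrr /cabs normr0 ltW.
suff -> : (fun K => \sum_(j <- i :: s | P j) G j K) = fun K =>
    (if P i then G i K else 0) + \sum_(j <- s | P j) G j K.
  rewrite big_cons; case: (P i); first exact: nlimD.
  by move=> d /IH[J hJ]; exists J => K /hJ; rewrite add0r.
by apply: funext => K; rewrite big_cons; case: (P i); rewrite ?add0r.
Qed.

Lemma nlim_pr x y : nlim (fun K => dot (pr K x) y) (dot x y).
Proof.
move=> d d0; have y1 : 0 < rn y + 1 by rewrite ltr_wpDl ?rn_ge0.
have [J hJ] := onb_dense x (divr_gt0 d0 y1); exists J => K /hJ; rewrite ler_pdivlMr // => h.
rewrite -dotNl -dotDl; apply: le_trans (cabs_dot hdot _ _) _; rewrite rnBC.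
by apply: le_trans h; rewrite ler_wpM2l ?rn_ge0 //; lra.
Qed.

Lemma nlim_re G l G' l' : nlim G l -> nlim G' l' -> (forall K, Re (G K) <= Re (G' K)) ->
  Re l <= Re l'.
Proof.
move=> h h' le; apply/ler_addgt0Pr => d d0; have d2 : 0 < d / 2 by lra.
have [J hJ] := h _ d2; have [J' hJ'] := h' _ d2.
have := le_trans (Re_le_cabs _) (hJ (J `|` J')%fset (fsubsetUl _ _)).
have := le_trans (Re_le_cabs _) (hJ' (J `|` J')%fset (fsubsetUr _ _)).
rewrite !cReD !cReN !ler_norml => /andP[a b] /andP[a' b'].
by have := le (J `|` J')%fset; lra.
Qed.

Lemma nlim_trace T s : nlim (fun K => \sum_(e <- K | e \in E) dot (T e) e) s <->
  summability.partial_sum (fun e => if e \in E then dot (T e) e else 0 : C)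
    @ summability.totally --> s.
Proof.
have tot := @summability.totally_filter H.
have sumE K : summability.partial_sum (fun e => if e \in E then dot (T e) e else 0 : C) K =
    \sum_(e <- K | e \in E) dot (T e) e.
  by rewrite [RHS]big_mkcond big_seq_fsetE.
split.
  move=> h; apply/complex_cvgP => d d0; have [J hJ] := h d d0.
  by exists J => // K JK /=; rewrite sumE; exact: hJ.
move=> /complex_cvgP h d d0; have [J _ hJ] := h d d0; exists J => K JK.
by have := hJ K JK; rewrite /= sumE.
Qed.

Lemma traceE T s : nlim (fun K => \sum_(e <- K | e \in E) dot (T e) e) s -> trace dot T = s.
Proof.
have tot := @summability.totally_filter H.
by move/nlim_trace => h; apply: cvg_lim.
Qed.

(** The limit of a divergent net defaults to 0, so a nonzero trace certifies convergence. This is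
    applied to the trace 1 of a state. *)
Lemma trace_nlim T s : s != 0 -> trace dot T = s ->
  nlim (fun K => \sum_(e <- K | e \in E) dot (T e) e) s.
Proof.
move=> s0 hs; apply/nlim_trace; rewrite -hs.
apply: contrapT => h; move/eqP: s0; apply; rewrite -hs.
exact: (dvgP h).
Qed.
End Basis.

(** * The trace of a state against an operator *)

Section Trace.
Variables (R : realType) (H : completeNormedModType (cplx R)).
Local Notation C := (cplx R).
Variable dot : {dot H for @Num.conj C}.
Hypothesis hdot : dot_norm dot.
Local Notation rd := (redot dot).
Local Notation E := (onb dot).
Local Notation pr := (onb_proj dot).
Implicit Types (J K : {fset H}) (x y e f : H) (a b : H -> R).

Definition onb_sum a J : R := \sum_(e <- J | e \in E) a e.
Definition has_onb_sum a (s : R) := nlim (fun J => (onb_sum a J)%:C : C) s%:C.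

Lemma has_onb_sumP a s : has_onb_sum a s <-> forall d : R, 0 < d ->
  exists J, forall K, (J `<=` K)%fset -> `|onb_sum a K - s| <= d.
Proof.
by split=> h d /h[J hJ]; exists J => K /hJ; rewrite -rmorphB cabsR.
Qed.

Lemma onb_sum_ext J K (P Q : pred H) a :
  (forall e, (e \in J) && P e = (e \in K) && Q e) ->
  \sum_(e <- J | P e) a e = \sum_(e <- K | Q e) a e.
Proof.
move=> h; rewrite -big_filter -[RHS]big_filter; apply: perm_big.
apply: uniq_perm; rewrite ?filter_uniq ?fset_uniq // => e.
by rewrite !mem_filter ![_ && (e \in _)]andbC h.
Qed.

Lemma onb_sumD a b s t : has_onb_sum a s -> has_onb_sum b t ->
  has_onb_sum (fun e => a e + b e) (s + t).
Proof.
move=> ha hb; rewrite /has_onb_sum rmorphD; have := nlimD ha hb.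
by congr (nlim _ _); apply: funext => J; rewrite /onb_sum big_split rmorphD.
Qed.

Lemma onb_sumZ (k : R) a s : has_onb_sum a s -> has_onb_sum (fun e => k * a e) (k * s).
Proof.
move=> ha; rewrite /has_onb_sum rmorphM; have := nlimZ k%:C ha.
by congr (nlim _ _); apply: funext => J; rewrite /onb_sum -mulr_sumr rmorphM.
Qed.

Lemma onb_sum_le a b s t : has_onb_sum a s -> has_onb_sum b t ->
  (forall e, a e <= b e) -> s <= t.
Proof. by move=> ha hb ab; apply: (nlim_re ha hb) => J /=; apply: ler_sum. Qed.

Lemma onb_sum_nonneg a (c : R) : (forall e, 0 <= a e) -> (forall J, onb_sum a J <= c) ->
  exists s, has_onb_sum a s.
Proof.
move=> a0 hc; pose V := [set onb_sum a J | J in [set: {fset H}]].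
have V0 : V !=set0 by exists (onb_sum a fset0); exists fset0.
have ubV : has_ubound V by exists c => _ [J _ <-].
exists (sup V); apply/has_onb_sumP => d d0.
have [|_ [J _ <-] hJ] := @sup_adherent _ V d d0; first by split.
exists J => K JK; have KV : onb_sum a K <= sup V by apply: ub_le_sup => //; exists K.
have : onb_sum a J <= onb_sum a K.
  rewrite /onb_sum [X in _ <= X](bigID (mem J)) /=.
  rewrite (@onb_sum_ext J K (fun e => e \in E) (fun e => (e \in E) && (e \in J))).
    by rewrite lerDl sumr_ge0.
  move=> e; case: (boolP (e \in J)) => [eJ|]; last by rewrite andbF andbF.
  by rewrite (fsubsetP JK _ eJ) andbT.
by rewrite ler_norml => ?; apply/andP; split; lra.
Qed.

Lemma onb_sum_tail a s (d : R) : (forall e, 0 <= a e) -> has_onb_sum a s -> 0 < d ->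
  exists J, forall J' K, (J `<=` J')%fset ->
    \sum_(e <- K | (e \in E) && (e \notin J')) a e <= d.
Proof.
move=> a0 /has_onb_sumP ha d0; have d2 : 0 < d / 2 by lra.
have [J hJ] := ha _ d2; exists J => J' K JJ'.
have := hJ J' JJ'; have := hJ (J' `|` K)%fset (fsubset_trans JJ' (fsubsetUl _ _)).
rewrite /onb_sum (bigID (mem J')) /=.
rewrite (@onb_sum_ext J' (J' `|` K)%fset (fun e => e \in E)
  (fun e => (e \in E) && (e \in J'))); last first.
  by move=> e; rewrite in_fsetU; case: (e \in J'); rewrite ?andbF ?andbT.
rewrite (@onb_sum_ext K (J' `|` K)%fset (fun e => (e \in E) && (e \notin J'))
  (fun e => (e \in E) && (e \notin J'))); last first.
  by move=> e; rewrite in_fsetU; case: (e \in J'); rewrite ?andbF ?andbT.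
by rewrite !ler_norml => /andP[_ h1] /andP[h2 _]; lra.
Qed.

(** Both sums are the double sum of the [|<S e, f>|^2]. To exchange only finite sums, [S e] is first
    projected to a finite set [K]; Bessel bounds the inner sum by [|S' f|^2], and [K] then grows. *)
Lemma hilbert_schmidt_adjoint_le S S' (c : R) : adjoint_of dot S S' ->
  (forall K, onb_sum (fun f => rn (S' f) ^+ 2) K <= c) ->
  forall J, onb_sum (fun e => rn (S e) ^+ 2) J <= c.
Proof.
move=> adj hc J.
have lim : nlim (fun K => (onb_sum (fun e => rn (pr K (S e)) ^+ 2) J)%:C : C)
    (onb_sum (fun e => rn (S e) ^+ 2) J)%:C.
  have : nlim (fun K => \sum_(e <- J | e \in E) dot (pr K (S e)) (S e) : C)
     (\sum_(e <- J | e \in E) dot (S e) (S e)).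
    by apply: nlim_sum => e; exact: nlim_pr.
  rewrite /onb_sum rmorph_sum /=; congr (nlim _ _); last first.
    by apply: eq_bigr => e _; rewrite (dotxx hdot).
  apply: funext => K; rewrite rmorph_sum /=; apply: eq_bigr => e _.
  rewrite -(dotxx hdot) -[in LHS](subrK (pr K (S e)) (S e)) dotDr.
  by rewrite dotC pr_ortho ?fsubset_refl // conjC0 add0r subrK.
have cc : nlim (fun _ : {fset H} => c%:C : C) c%:C.
  by move=> d d0; exists fset0 => K _; rewrite subrr /cabs normr0 ltW.
have := nlim_re lim cc; apply=> K /=; apply: le_trans (hc K).
rewrite /onb_sum; under eq_bigr do rewrite (rn2_pr hdot).
rewrite exchange_big /=; apply: ler_sum => f _.
under eq_bigr => e _ do rewrite adj dotC cabsJ.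
exact: bessel.
Qed.

(** Cyclicity of the trace: [r r T] and [r T r] have the same trace when [r] is Hilbert-Schmidt. *)
Lemma nlim_trace_sqrt (r T : H -> H) (s : R) :
  bounded_operator r -> self_adjoint dot r ->
  bounded_operator T -> self_adjoint dot T ->
  has_onb_sum (fun f => rn (r f) ^+ 2) s ->
  exists2 t : R, has_onb_sum (fun f => rd (T (r f)) (r f)) t &
    nlim (fun J => \sum_(e <- J | e \in E) dot (r (r (T e))) e : C) t%:C.
Proof.
move=> br sr bT sT hs; have [M M0 hM] := bop_bound bT.
pose w f := rn (r f) ^+ 2; pose a f := rd (T (r f)) (r f).
have w0 f : 0 <= w f by rewrite sqr_ge0.
have aw f : `|a f| <= M * w f.
  apply: le_trans (rd_le hdot _ _) _; rewrite /w expr2 mulrA.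
  by rewrite ler_wpM2r ?rn_ge0.
have [t ht] : exists t, has_onb_sum a t.
  have [J1 hJ1] := (has_onb_sumP _ _).1 hs 1 ltr01.
  have wbound J : onb_sum w J <= s + 1.
    have := hJ1 (J1 `|` J)%fset (fsubsetUl _ _); rewrite ler_norml => /andP[_].
    rewrite /onb_sum (bigID (mem J)) /=.
    rewrite -(@onb_sum_ext J (J1 `|` J)%fset (fun e => e \in E)
      (fun e => (e \in E) && (e \in J))); last first.
      by move=> e; rewrite in_fsetU; case: (e \in J); rewrite ?orbT ?andbF ?andbT.
    have : 0 <= \sum_(e <- (J1 `|` J)%fset | (e \in E) && (e \notin J)) w e by rewrite sumr_ge0.
    by rewrite /w; lra.
  (* Adding [M w] makes the terms nonnegative, so that bounded partial sums converge; [M s] is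
     subtracted afterwards. *)
  have [|J|u hu] := @onb_sum_nonneg (fun f => a f + M * w f) (2 * M * (s + 1)).
  - by move=> f; have := aw f; rewrite ler_norml => /andP[]; lra.
  - apply: (@le_trans _ _ (2 * M * onb_sum w J)); last first.
      by rewrite ler_wpM2l // mulr_ge0 // ltW.
    rewrite /onb_sum mulr_sumr; apply: ler_sum => f _.
    by have := aw f; rewrite ler_norml => /andP[]; lra.
  exists (u + (- M) * s); have := onb_sumD hu (onb_sumZ (- M) hs).
  by congr has_onb_sum; apply: funext => f; rewrite /w; lra.
exists t => // d d0; have d3 : 0 < d / 3 by lra.
(* Chosen so that the two tails below add up to [M^2 eta + eta = d / 3]. *)
pose eta := d / 3 / (M ^+ 2 + 1).
have M1 : 0 < M ^+ 2 + 1 by rewrite ltr_wpDl // sqr_ge0.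
have eta0 : 0 < eta by rewrite divr_gt0.
have [J1 hJ1] := onb_sum_tail w0 hs eta0.
have [J2 hJ2] := (has_onb_sumP _ _).1 ht _ d3.
pose J0 := (J1 `|` J2)%fset.
have finite_part : nlim (fun J => \sum_(f <- J0 | f \in E) dot (pr J (r f)) (T (r f)) : C)
    (onb_sum a J0)%:C.
  have : nlim (fun J => \sum_(f <- J0 | f \in E) dot (pr J (r f)) (T (r f)) : C)
      (\sum_(f <- J0 | f \in E) dot (r f) (T (r f))).
    by apply: nlim_sum => f; exact: nlim_pr.
  congr (nlim _ _); rewrite /onb_sum rmorph_sum; apply: eq_bigr => f _.
  by rewrite /a -sT; apply: complex_eq => //; rewrite (dot_sa_real sT).
have [J3 hJ3] := finite_part _ d3; exists J3 => J J3J.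
pose Q x := x - pr J0 x.
have Qsa : self_adjoint dot Q.
  by move=> x y; rewrite /Q dotDl dotDr dotNl dotNr pr_sa.
have QQ x y : dot (Q x) y = dot (Q x) (Q y).
  by rewrite [in RHS]/Q dotDr dotNr pr_ortho ?fsubset_refl // subr0.
(* The identity is split as [pr J0 + Q] between the two factors [r]. The first part is a finite sum
   over [f], where the order of summation can be exchanged. *)
have split_e e : dot (r (r (T e))) e =
    \sum_(f <- J0 | f \in E) dot e (T (r f)) * dot (r f) e + dot (Q (r (T e))) (Q (r e)).
  rewrite sr -QQ -[X in dot X _ = _](subrK (pr J0 (r (T e)))) dotDl addrC; congr (_ + _).
  by rewrite dot_pr; apply: eq_bigr => f _; rewrite !sr sT -sr.
under eq_bigr do rewrite split_e.
rewrite big_split exchange_big /=.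
have -> : \sum_(f <- J0 | f \in E) \sum_(e <- J | e \in E) dot e (T (r f)) * dot (r f) e =
    \sum_(f <- J0 | f \in E) dot (pr J (r f)) (T (r f)).
  apply: eq_bigr => f _; rewrite dot_pr; apply: eq_bigr => e _; exact: mulrC.
(* [Q] kills the basis vectors in [J0], so the sum of the [|r Q f|^2] is a tail. Passing to adjoints
   transfers its smallness to the sums of the [|Q r e|^2] and [|Q r T e|^2], which dominate the
   products. *)
have rest : cabs (\sum_(e <- J | e \in E) dot (Q (r (T e))) (Q (r e))) <= d / 3.
  have Qtail K : onb_sum (fun f => rn (r (Q f)) ^+ 2) K <= eta.
    apply: le_trans (hJ1 J0 K (fsubsetUl _ _)); rewrite /onb_sum (bigID (mem J0)) /=.
    rewrite big1 ?add0r.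
      apply: ler_sum => f /andP[Ef fJ0]; rewrite /Q /w.
      suff -> : pr J0 f = 0 by rewrite subr0.
      rewrite /onb_proj big_seq_cond big1 // => e /andP[eJ Ee].
      rewrite dot_onb //; case: eqP eJ fJ0 => [->->//|]; by rewrite scale0r.
    move=> f /andP[Ef fJ0]; rewrite /Q.
    suff -> : pr J0 f = f by rewrite subrr (lin0 (bop_lin br)) rn0 expr0n.
    apply: (dot_ext hdot) => z; rewrite /redot; congr Re.
    rewrite dot_pr big_mkcond (bigD1_seq f) ?fset_uniq //= Ef dot_onb // eqxx mul1r.
    rewrite big1 ?addr0 // => e ef; case: ifP => // Ee.
    by rewrite dot_onb // eq_sym (negPf ef) mul0r.
  have h1 := hilbert_schmidt_adjoint_le (adj_comp Qsa sr) Qtail J.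
  have Ttail K : onb_sum (fun f => rn (T (r (Q f))) ^+ 2) K <= M ^+ 2 * eta.
    apply: le_trans (ler_wpM2l (sqr_ge0 M) (Qtail K)); rewrite /onb_sum mulr_sumr.
    apply: ler_sum => f _; rewrite -exprMn ler_pXn2r ?nnegrE ?rn_ge0 //.
    by rewrite mulr_ge0 ?rn_ge0 ?ltW.
  have h2 := hilbert_schmidt_adjoint_le (adj_comp Qsa (adj_comp sr sT)) Ttail J.
  have -> : d / 3 = M ^+ 2 * eta + eta by rewrite /eta; field; rewrite gt_eqF.
  apply: (@le_trans _ _ (onb_sum (fun e => rn (Q (r (T e))) ^+ 2 + rn (Q (r e)) ^+ 2) J)).
    rewrite /onb_sum; elim/big_ind2: _ => [|x x' y y' h h'|e _].
    - by rewrite /cabs normr0.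
    - by apply: le_trans (cabsD _ _) _; exact: lerD.
    apply: le_trans (cabs_dot hdot _ _) _.
    have := sqr_ge0 (rn (Q (r (T e))) - rn (Q (r e))).
    have := sqr_ge0 (rn (Q (r (T e))) + rn (Q (r e))).
    by nra.
  by rewrite /onb_sum big_split; apply: lerD.
have := hJ3 J J3J; have := hJ2 J0 (fsubsetUr _ _); move: rest.
set X := (X in cabs X <= _); set Y := \sum_(f <- J0 | _) _; set Z := onb_sum a J0 => h1 h2 h3.
have -> : Y + X - t%:C = (Y - Z%:C) + (X + (Z - t)%:C) by rewrite rmorphB; ring.
apply: le_trans (cabsD _ _) _; have := cabsD X (Z - t)%:C; rewrite cabsR; lra.
Qed.

End Trace.

(** * Variances *)

Section Variance.
Variables (R : realType) (H : completeNormedModType (cplx R)).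
Local Notation C := (cplx R).
Variable dot : {dot H for @Num.conj C}.
Hypothesis hdot : dot_norm dot.
Local Notation rd := (redot dot).
Local Notation E := (onb dot).
Implicit Types (x y : H) (A B T rho : H -> H).

Lemma trace_pure_state x T : self_adjoint dot T ->
  trace dot (pure_state dot x \o T) = dot x (T x).
Proof.
move=> sT; apply: traceE; have := nlim_pr hdot x (T x).
congr (nlim _ _); apply: funext => J; rewrite dot_pr.
by apply: eq_bigr => e _; rewrite /= /pure_state dotZl sT mulrC.
Qed.

Lemma pure_variance x A : self_adjoint dot A ->
  state_variance dot (pure_state dot x) A = (rn (A x) ^+ 2 - rd (A x) x ^+ 2)%:C.
Proof.
move=> sA; rewrite /state_variance -compA.
rewrite (trace_pure_state x sA) (trace_pure_state x (adj_comp sA sA)) /= -sA (dotxx hdot).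
suff -> : dot x (A x) = (rd (A x) x)%:C by rewrite -rmorphXn -rmorphB.
by rewrite -sA; apply: complex_eq => //=; rewrite (dot_sa_real sA).
Qed.

Lemma pure_state_is_state x : rn x = 1 -> state dot (pure_state dot x).
Proof.
move=> x1; set P := pure_state dot x.
have dotP y : dot (P y) y = (cabs (dot x y) ^+ 2)%:C.
  by rewrite /P /pure_state dotZl (dotC dot y) mulrC mulJ.
have pP : positive_operator dot P by move=> y; rewrite dotP ler0c sqr_ge0.
have bP : bounded_operator P.
  apply: (@bop_intro _ _ _ 1) => [a y z|y]; rewrite /P /pure_state.
    by rewrite dotDl dotZl scalerDl scalerA.
  by rewrite rnZ x1 mulr1 mul1r; have := cabs_dot hdot y x; rewrite x1 mulr1.
have sP := positive_self_adjoint (bop_lin bP) pP.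
split=> //.
(* A positive operator is its own absolute value; Bessel bounds the sum of the [|<x, e>|^2]. *)
- split=> //; exists P; first by split=> //; exists P.
  apply: (@le_lt_trans _ _ 1%:E); last exact: ltry.
  apply: ge_ereal_sup => _ [F [finF FE] <-].
  rewrite fsbig_finite //= sumEFin lee_fin.
  have := bessel hdot (fset_set F) x; rewrite x1 expr1n; apply: le_trans.
  rewrite [X in _ <= X]big_mkcond big_seq_cond [X in _ <= X]big_seq_cond.
  apply: ler_sum => e /andP[+ _]; rewrite in_fset_set // => /set_mem/FE/mem_set ->.
  by rewrite dotP.
- have idsa : self_adjoint dot id by [].
  by have := trace_pure_state x idsa; rewrite (dotxx hdot) x1 expr1n.
Qed.

(** With [rho = r^2], the state acts as a mixture of the vectors [r f], whose squared norms add up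
    to 1; inequalities between operators can then be summed term by term. *)
Lemma state_trace rho : state dot rho -> exists r, bounded_operator r /\
  has_onb_sum dot (fun f => rn (r f) ^+ 2) 1 /\
  forall T, bounded_operator T -> self_adjoint dot T ->
    exists2 t : R, has_onb_sum dot (fun f => rd (T (r f)) (r f)) t &
      trace dot (rho \o T) = t%:C.
Proof.
case=> prho [brho _] tr1; have srho := positive_self_adjoint (bop_lin brho) prho.
have [r [br sr rr]] := positive_sqrt hdot brho srho prho.
have h1 : has_onb_sum dot (fun f => rn (r f) ^+ 2) 1.
  have := trace_nlim (oner_neq0 _) tr1; rewrite /has_onb_sum.
  congr (nlim _ _); apply: funext => J; rewrite /onb_sum rmorph_sum.
  by apply: eq_bigr => e _; rewrite -rr sr (dotxx hdot).
exists r; split=> //; split=> // T bT sT.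
have [t ht lt] := nlim_trace_sqrt hdot br sr bT sT h1; exists t => //.
apply: traceE; move: lt; congr (nlim _ _); apply: funext => J.
by apply: eq_bigr => e _; rewrite rr.
Qed.

(* The variance of A in a state is the minimum over c of the expectation of (A - c)^2. *)
Lemma variance_le rho A B : state dot rho ->
  bounded_operator A -> self_adjoint dot A -> bounded_operator B -> self_adjoint dot B ->
  (forall m : R, exists c : R, forall x, rn (A x - c%:C *: x) <= rn (B x - m%:C *: x)) ->
  state_variance dot rho A <= state_variance dot rho B.
Proof.
move=> /state_trace[r [br [h1 htr]]] bA sA bB sB hAB.
(* The sum is the expectation of [(T - c)^2], expanded into the first two moments [t] and [t2] of
   [T]. *)
have second T c t t2 : self_adjoint dot T ->
    has_onb_sum dot (fun f => rd (T (r f)) (r f)) t ->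
    has_onb_sum dot (fun f => rd ((T \o T) (r f)) (r f)) t2 ->
    has_onb_sum dot (fun f => rn (T (r f) - c%:C *: r f) ^+ 2) (t2 + (- (2 * c) * t + c ^+ 2 * 1)).
  move=> sT ht ht2.
  have := onb_sumD ht2 (onb_sumD (onb_sumZ (- (2 * c)) ht) (onb_sumZ (c ^+ 2) h1)).
  congr (has_onb_sum _ _); apply: funext => f /=.
  rewrite (rn2B hdot) rnZr rdZr exprMn real_normK ?num_real // (rd_sa sT) (rdxx hdot); ring.
have [a ha trA] := htr A bA sA; have [b hb trB] := htr B bB sB.
have [a2 ha2 trA2] := htr _ (bop_comp bA bA) (adj_comp sA sA).
have [b2 hb2 trB2] := htr _ (bop_comp bB bB) (adj_comp sB sB).
have tA2 : trace dot (rho \o A \o A) = a2%:C by exact: trA2.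
have tB2 : trace dot (rho \o B \o B) = b2%:C by exact: trB2.
rewrite /state_variance trA tA2 trB tB2 -!rmorphXn -!rmorphB /= lecR.
(* At the mean [b] of [B] the right side is exactly the variance of [B]; the left side exceeds the
   variance of [A] by [(a - c)^2]. *)
have [c hc] := hAB b; have := onb_sum_le (second A c _ _ sA ha ha2) (second B b _ _ sB hb hb2) _.
have -> : (forall e, rn (A (r e) - c%:C *: r e) ^+ 2 <= rn (B (r e) - b%:C *: r e) ^+ 2) = True.
  by rewrite propeqE; split=> // _ e; rewrite ler_pXn2r ?nnegrE ?rn_ge0.
move=> /(_ I); have := sqr_ge0 (a - c); nra.
Qed.

End Variance.

(** * Spectral subspaces *)

Section SpectralSubspaces.
Variables (R : realType) (H : completeNormedModType (cplx R)).
Local Notation C := (cplx R).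
Variable dot : {dot H for @Num.conj C}.
Hypothesis hdot : dot_norm dot.
Local Notation rd := (redot dot).
Variable B : H -> H.
Hypotheses (bB : bounded_operator B) (sB : self_adjoint dot B).
Local Notation cts := (continuous_on_spectrum B).
Local Notation fc := (cfc dot B).
Implicit Types (x y u v w : H) (s t d : R).

Definition op_shift s w : H := B w - s%:C *: w.
Local Notation shift := op_shift.

Lemma bop_shiftR s : bounded_operator (shift s).
Proof. exact: bop_shift. Qed.
Lemma sa_shift s : self_adjoint dot (shift s).
Proof.
have := adj_shift s%:C sB; congr adjoint_of; apply: funext => x.
by rewrite /shift; congr (_ - _ *: _); apply: complex_eq => //=; rewrite oppr0.
Qed.

(* For a self-adjoint B this is the spectral subspace of the interval [s - d, s + d]. *)
Definition spectral_subspace s d w :=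
  exists M : R, forall n, rn (iter n (shift s) w) <= M * d ^+ n.

Lemma iter_shiftD s n x y : iter n (shift s) (x + y) = iter n (shift s) x + iter n (shift s) y.
Proof. by elim: n => //= n ->; rewrite (linD _ _ (bop_lin (bop_shiftR s))). Qed.
Lemma iter_shiftZ s n a x : iter n (shift s) (a *: x) = a *: iter n (shift s) x.
Proof. by elim: n => //= n ->; rewrite (linZ _ _ (bop_lin (bop_shiftR s))). Qed.

Lemma spectral_subspaceD s d x y : spectral_subspace s d x -> spectral_subspace s d y ->
  spectral_subspace s d (x + y).
Proof.
move=> [M hM] [N hN]; exists (M + N) => n; rewrite iter_shiftD mulrDl.
by apply: le_trans (rnD _ _) _; apply: lerD.
Qed.
Lemma spectral_subspaceZ s d a x : spectral_subspace s d x -> spectral_subspace s d (a *: x).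
Proof.
move=> [M hM]; exists (cabs a * M) => n; rewrite iter_shiftZ rnZ -mulrA.
by rewrite ler_wpM2l ?cabs_ge0.
Qed.
Lemma spectral_subspace_le s d d' x : 0 <= d -> d <= d' -> spectral_subspace s d x ->
  spectral_subspace s d' x.
Proof.
move=> d0 dd [M hM]; exists `|M| => n; apply: le_trans (hM n) _.
apply: (@le_trans _ _ (`|M| * d ^+ n)).
  by rewrite ler_wpM2r ?exprn_ge0 // ler_norm.
by rewrite ler_wpM2l // lerXn2r ?nnegrE // (le_trans d0).
Qed.

(* The sequence of the |(B - s)^n w| is log-convex, so that it grows at least
   like a geometric sequence with ratio |(B - s) w| / |w|. *)
Lemma spectral_subspace_bound s d w : 0 < d -> spectral_subspace s d w ->
  rn (shift s w) <= d * rn w.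
Proof.
move=> d0 [M hM]; pose m n := rn (iter n (shift s) w).
have conv n : m n.+1 ^+ 2 <= m n.+2 * m n.
  rewrite /m -(rdxx hdot) [X in rd _ X]iterS -(rd_sa (sa_shift s)) -iterS.
  by apply: le_trans (ler_norm _) (rd_le hdot _ _).
rewrite leNgt; apply/negP => h.
have w0 : 0 < rn w.
  apply: rn_gt0; apply/eqP => w0; move: h.
  by rewrite w0 (lin0 (bop_lin (bop_shiftR s))) rn0 mulr0 ltxx.
pose q := rn (shift s w) / rn w.
have dq : d < q by rewrite ltr_pdivlMr.
have q0 : 0 < q by apply: lt_trans dq.
have grow n : 0 < m n /\ q * m n <= m n.+1.
  elim: n => [|n [IH1 IH2]]; first by rewrite /m /= /q divfK ?gt_eqF.
  have m1 : 0 < m n.+1 by apply: lt_le_trans IH2; exact: mulr_gt0.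
  split=> //; rewrite -(ler_pM2r IH1); apply: le_trans (conv n).
  by rewrite mulrAC expr2 ler_pM2r.
have geo n : q ^+ n * rn w <= m n.
  elim: n => [|n IH]; first by rewrite mul1r.
  by rewrite exprS -mulrA; apply: le_trans (grow n).2; rewrite ler_pM2l.
have M0 : 0 < M by have := hM 0%N; rewrite /= mulr1; apply: lt_le_trans.
have dq0 : 0 <= d / q by rewrite divr_ge0 // ltW.
have r01 : `|d / q| < 1 by rewrite ger0_norm // ltr_pdivrMr // mul1r.
have e0 : 0 < rn w / (2 * M) by rewrite divr_gt0 // mulr_gt0.
have /cvgrPdist_le/(_ _ e0)[N _ hN] : ((d / q) ^+ n @[n --> \oo] --> (0 : R)) by exact: cvg_expr.
have := hN N (leqnn N); rewrite sub0r normrN ger0_norm; last first.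
  by rewrite exprn_ge0.
have := le_trans (geo N) (hM N) => h1.
rewrite exprMn exprVn ler_pdivrMr ?exprn_gt0 // => h2.
have h3 : M * d ^+ N <= q ^+ N * rn w / 2.
  apply: le_trans (ler_wpM2l (ltW M0) h2) _.
  by rewrite le_eqVlt; apply/orP; left; apply/eqP; field; rewrite gt_eqF.
by have : 0 < q ^+ N * rn w by [rewrite mulr_gt0 ?exprn_gt0]; lra.
Qed.

(** The hypothesis says that on the spectrum [f] vanishes outside [[s - d, s + d]]. There
    [|(z - s)^n f|] is at most [d^n |f|], and [fc_le] carries this over to vectors. *)
Lemma fc_spectral_subspace (f : C -> C) s d x : 0 <= d -> cts f ->
  (forall z, spectrum B z -> `|Re z - s| * cabs (f z) <= d * cabs (f z)) ->
  spectral_subspace s d (fc f x).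
Proof.
move=> d0 cf hf; exists (rn (fc f x)) => n.
have cs : cts (fun z => z - s%:C) by have := ctsD (@cts_id _ _ B) (@cts_cst _ _ B (- s%:C)).
have ci k : cts (fun z => (z - s%:C) ^+ k * f z).
  elim: k => [|k IH]; first by have -> : (fun z => (z - s%:C) ^+ 0 * f z) = f
    by apply: funext => z; rewrite mul1r.
  have := ctsM cs IH; congr continuous_on_spectrum; apply: funext => z /=.
  by rewrite exprS mulrA.
have it k : iter k (shift s) (fc f x) = fc (fun z => (z - s%:C) ^+ k * f z) x.
  elim: k => [|k IH] /=.
    by congr fc; apply: funext => z; rewrite mul1r.
  rewrite IH /shift -(fc_id_sub_cst hdot bB sB) -(fc_mul hdot bB sB _ cs (ci k)).
  by congr fc; apply: funext => z; rewrite exprS mulrA.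
have cd : cts (fun z => (d ^+ n)%:C * f z) by exact: cts_scale.
rewrite it; apply: le_trans (fc_le hdot bB sB x (ci n) cd _) _.
  move=> z sz; have zE := spectrumE hdot bB sB sz.
  rewrite !cabsM cabsR ger0_norm ?exprn_ge0 //.
  have -> : cabs ((z - s%:C) ^+ n) = `|Re z - s| ^+ n.
    by rewrite zE -rmorphB -rmorphXn cabsR normrX.
  have := hf z sz; move: (`|_|) (normr_ge0 (Re z - s)) (cabs (f z)) (cabs_ge0 (f z)).
  move=> a a0 b b0; have [->|bn] := eqVneq b 0; first by rewrite !mulr0.
  have bp : 0 < b by rewrite lt_neqAle eq_sym bn.
  by rewrite !ler_pM2r // => ad; rewrite lerXn2r ?nnegrE.
have isf := cfcP hdot bB sB.
by rewrite (cfc_scale isf _ cf) rnZr ger0_norm ?exprn_ge0 // mulrC.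
Qed.

(** The hat function [max(0, 1 - |a|)], written with absolute values so that its Lipschitz bound
    follows from the triangle inequality. *)
Definition tent (a : R) : R := (`|a + 1| - 2 * `|a| + `|a - 1|) / 2.

Lemma tentP (a : R) : [/\ 0 <= tent a, tent a <= 1, 1 <= tent a + `|a| &
  tent a != 0 -> `|a| <= 1].
Proof.
rewrite /tent; have [|] := ler0P a; have [|] := ler0P (a + 1); have [|] := ler0P (a - 1).
all: by move=> h1 h2 h3; split; try lra; move/eqP => h; apply: contrapT => h'; apply: h; lra.
Qed.

Lemma tent_lipschitz (a b : R) : `|tent a - tent b| <= 2 * `|a - b|.
Proof.
have h c : `| `|a + c| - `|b + c| | <= `|a - b|.
  by apply: le_trans (ler_dist_dist _ _) _; rewrite opprD addrACA subrr addr0.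
have := h 1; have := h 0; have := h (-1); rewrite !addr0 /tent !ler_norml.
by move=> /andP[? ?] /andP[? ?] /andP[? ?]; apply/andP; split; lra.
Qed.

(** Each tent is a difference of two consecutive translates of a ramp that rises from 0 to 1 on
    [[0, 1]], so the sum telescopes. *)
Lemma tent_sum n (a : R) : 1 <= a <= n.+1%:R -> \sum_(k < n.+1) tent (a - k.+1%:R) = 1.
Proof.
move=> /andP[a1 an]; pose ramp (b : R) := (1 + `|b| - `|b - 1|) / 2.
have tE k : tent (a - k.+1%:R) = ramp (a - k%:R) - ramp (a - k.+1%:R).
  rewrite /ramp /tent -natr1; have -> : a - (k%:R + 1) + 1 = a - k%:R by ring.
  have -> : a - k%:R - 1 = a - (k%:R + 1) by ring.
  by lra.
have -> : \sum_(k < n.+1) tent (a - k.+1%:R) = ramp a - ramp (a - n.+1%:R).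
  elim: {an}n.+1 => [|m IH]; first by rewrite big_ord0 subr0 subrr.
  by rewrite big_ord_recr /= IH tE; ring.
rewrite /ramp (ger0_norm (_ : 0 <= a)) ?(ger0_norm (_ : 0 <= a - 1)); try lra.
rewrite (ler0_norm (_ : a - n.+1%:R <= 0)) ?(ler0_norm (_ : a - n.+1%:R - 1 <= 0)); try lra.
Qed.

End SpectralSubspaces.

(** * The values of the function f *)

Section Core.
Variables (R : realType) (H : completeNormedModType (cplx R)).
Local Notation C := (cplx R).
Variable dot : {dot H for @Num.conj C}.
Hypothesis hdot : dot_norm dot.
Local Notation rd := (redot dot).
Variables A B : H -> H.
Hypothesis bA : bounded_operator A.
Hypotheses (bB : bounded_operator B) (sB : self_adjoint dot B).
Local Notation cts := (continuous_on_spectrum B).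
Local Notation fc := (cfc dot B).
Local Notation shift := (op_shift B).
Local Notation subspace := (spectral_subspace B).
Implicit Types (x y u v w : H) (s t d : R).

Lemma normalize x : x != 0 -> exists u,
  [/\ rn u = 1, u = ((rn x)^-1)%:C *: x & x = (rn x)%:C *: u].
Proof.
move=> x0; have xp := rn_gt0 x0; exists (((rn x)^-1)%:C *: x); split=> //.
  by rewrite rnZr ger0_norm ?invr_ge0 ?rn_ge0 // mulVf // gt_eqF.
by rewrite scalerA -rmorphM divff ?gt_eqF // scale1r.
Qed.

Lemma tent_cos s d : 0 < d -> cts (fun z => (tent ((Re z - s) / d))%:C).
Proof.
move=> d0; apply: (lipschitz_cos (L := 2 / d)) => z w _ _.
apply: le_trans (tent_lipschitz _ _) _.
rewrite -mulrBl normrM (@ger0_norm _ d^-1) ?invr_ge0 ?(ltW d0) // mulrA mulrAC.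
rewrite ler_wpM2l ?divr_ge0 ?(ltW d0) // opprB addrA subrK -cReN -cReD.
exact: Re_le_cabs.
Qed.

Lemma tent_support s d (z : C) : 0 < d -> 
  `|Re z - s| * cabs (tent ((Re z - s) / d))%:C <= d * cabs (tent ((Re z - s) / d))%:C.
Proof.
move=> d0; set a := (Re z - s) / d; have [_ _ _ h] := tentP a.
have [->|/h ha] := eqVneq (tent a) 0; first by rewrite /cabs normr0 !mulr0.
rewrite ler_wpM2r ?cabs_ge0 //; move: ha.
by rewrite /a normrM (@ger0_norm _ d^-1) ?invr_ge0 ?(ltW d0) // ler_pdivrMr // mul1r.
Qed.

(** If the tent around [s] were zero as an operator, [1 <= tent a + |a|] would give
    [d |x| <= |(B - s) x|], putting [s] off the spectrum. *)
Lemma spectral_subspace_unit s d : spectrum B s%:C -> 0 < d ->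
  exists2 u, rn u = 1 & subspace s d u.
Proof.
move=> ss d0; have ct := @tent_cos s d d0.
set f := (fun z : C => (tent ((Re z - s) / d))%:C) in ct.
have [[x hx]|none] := pselect (exists x, fc f x != 0).
  exists (((rn (fc f x))^-1)%:C *: fc f x).
    by rewrite rnZr ger0_norm ?invr_ge0 ?rn_ge0 // mulVf // gt_eqF // rn_gt0.
  apply: spectral_subspaceZ => //; apply: (fc_spectral_subspace hdot bB sB) => //; first exact: ltW.
  by move=> z _; exact: tent_support.
exfalso; apply: (not_spectrum_of_bounded_below hdot bB sB d0 _ ss) => x.
pose g (z : C) : C := (`|Re z - s| / d)%:C.
have cg : cts g.
  apply: (lipschitz_cos (L := d^-1)) => z w _ _.
  rewrite -mulrBl normrM (@ger0_norm _ d^-1) ?invr_ge0 ?(ltW d0) // mulrC.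
  rewrite ler_wpM2l ?invr_ge0 ?(ltW d0) //; apply: le_trans (ler_dist_dist _ _) _.
  by rewrite opprB addrA subrK -cReN -cReD Re_le_cabs.
have cgd : cts (fun z => d%:C * g z) by exact: cts_scale.
have cs : cts (fun z => z - s%:C) by have := ctsD (@cts_id _ _ B) (@cts_cst _ _ B (- s%:C)).
have isf := cfcP hdot bB sB.
have h1 : rn x <= rn (fc f x + fc g x).
  have /(congr1 (@^~ x)) /= <- := cfc_add isf ct cg.
  have /(congr1 (@^~ x)) /= {1}<- := cfc_one isf.
  apply: (fc_le hdot bB sB x (@cts_cst _ _ B 1) (ctsD ct cg)) => z _ /=.
  have -> : cabs (1 : C) = 1 by rewrite /cabs normr1.
  rewrite /f /g -rmorphD /= cabsR; apply: le_trans (ler_norm _).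
  have [_ _ + _] := tentP ((Re z - s) / d).
  by rewrite normrM (@ger0_norm _ d^-1) ?invr_ge0 ?(ltW d0).
have h2 : d * rn (fc g x) <= rn (shift s x).
  have /(congr1 (@^~ x)) /= e := cfc_scale isf d%:C cg.
  have -> : d * rn (fc g x) = rn (fc (fun z => d%:C * g z) x).
    by rewrite e rnZr ger0_norm // ltW.
  rewrite /op_shift -(fc_id_sub_cst hdot bB sB).
  apply: (fc_le hdot bB sB x cgd cs) => z _.
  rewrite /g -rmorphM /= mulrC divfK ?gt_eqF // cabsR normr_id.
  by have := Re_le_cabs (z - s%:C); rewrite cReD cReN.
have f0 : fc f x = 0 by apply: contrapT => /eqP h; apply: none; exists x.
move: h1; rewrite f0 add0r => h1; apply: le_trans h2; by rewrite ler_pM2l.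
Qed.

Definition mean u : R := rd (A u) u.

Hypothesis hAB : forall x, rn x = 1 ->
  rn (A x) ^+ 2 - rd (A x) x ^+ 2 <= rn (B x) ^+ 2 - rd (B x) x ^+ 2.

Lemma dist_line_le x s : exists a : R, rn (A x - a%:C *: x) <= rn (B x - s%:C *: x).
Proof.
have lA := bop_lin bA; have lB := bop_lin bB.
have [->|x0] := eqVneq x 0.
  by exists 0; rewrite (lin0 lA) (lin0 lB) !scaler0 subr0.
have [u [u1 _ xu]] := normalize x0.
have key : rn (A u - (mean u)%:C *: u) <= rn (B u - s%:C *: u).
  rewrite -(@ler_pXn2r _ 2) ?nnegrE ?rn_ge0 // !(rn2B hdot) !rnZr !rdZr u1 !mulr1.
  rewrite !real_normK ?num_real //; have := hAB u1; rewrite /mean.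
  by have := sqr_ge0 (s - rd (B u) u); nra.
have xA : A x = (rn x)%:C *: A u by rewrite {1}xu (linZ _ _ lA).
have xB : B x = (rn x)%:C *: B u by rewrite {1}xu (linZ _ _ lB).
exists (mean u); rewrite xA xB.
have sw (c : R) y : (rn x)%:C *: y - c%:C *: x = (rn x)%:C *: (y - c%:C *: u).
  by rewrite {2}xu scalerBr !scalerA [c%:C * _]mulrC.
by rewrite !sw !rnZr ler_wpM2l.
Qed.

Lemma unit_mean_le u s : rn u = 1 -> rn (A u - (mean u)%:C *: u) <= rn (shift s u).
Proof.
move=> u1; have [a ha] := dist_line_le u s; apply: le_trans ha.
rewrite -(@ler_pXn2r _ 2) ?nnegrE ?rn_ge0 // !(rn2B hdot) !rnZr !rdZr u1 !mulr1.
rewrite !real_normK ?num_real // /mean.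
by have := sqr_ge0 (a - rd (A u) u); nra.
Qed.

(** [A] maps [u + v] near [a (u + v)], but also [u] near [mean u] times [u], and [v] likewise;
    subtraction leaves the combination on the left. The free centres serve both one common interval
    and two distinct ones. *)
Lemma mean_combination u v s t m : rn u = 1 -> rn v = 1 -> exists a : R,
  rn ((mean u - a)%:C *: u + (mean v - a)%:C *: v) <=
    rn (shift m (u + v)) + rn (shift s u) + rn (shift t v).
Proof.
move=> u1 v1; have [a ha] := dist_line_le (u + v) m; exists a.
have hu := unit_mean_le s u1; have hv := unit_mean_le t v1.
have -> : (mean u - a)%:C *: u + (mean v - a)%:C *: v =
    (A (u + v) - a%:C *: (u + v)) - (A u - (mean u)%:C *: u) - (A v - (mean v)%:C *: v).
  rewrite (linD _ _ (bop_lin bA)) !rmorphB !scalerBl scalerDr.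
  have e (p p' q q' r r' : H) : p + p' - (q + q') - (p - r) - (p' - r') = (r - q) + (r' - q').
    have e1 (a1 b1 c1 : H) : a1 - b1 - (a1 - c1) = c1 - b1 by rewrite opprB addrC addrA subrK.
    by rewrite (opprD q) (addrACA p) -(addrA _ (- (p - r))) (addrACA (p - q)) !e1.
  by rewrite e.
apply: le_trans (rnB _ _) _; apply: lerD => //; apply: le_trans (rnB _ _) _.
exact: lerD.
Qed.

Lemma rn_comb_orth (p q : R) u v : rn u = 1 -> rn v = 1 ->
  rn (p%:C *: u + q%:C *: v) ^+ 2 = p ^+ 2 + q ^+ 2 + 2 * (p * q * rd u v).
Proof.
move=> u1 v1; rewrite (rn2D hdot) !rnZr u1 v1 !mulr1 !real_normK ?num_real //.
by rewrite rdZl rdZr; ring.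
Qed.

(** The combination has norm at most [2 d + d + d], and by orthogonality the square of its norm is
    at least half of [(mean u - mean v)^2]; this gives [32 d^2 <= (6 d)^2]. *)
Lemma mean_close_orth s d u v : 0 < d -> rn u = 1 -> rn v = 1 -> rd u v = 0 ->
  subspace s d u -> subspace s d v -> `|mean u - mean v| <= 6 * d.
Proof.
move=> d0 u1 v1 uv Eu Ev; have [a ha] := mean_combination s s s u1 v1.
have hu := spectral_subspace_bound hdot bB sB d0 Eu.
have hv := spectral_subspace_bound hdot bB sB d0 Ev.
have huv := spectral_subspace_bound hdot bB sB d0 (spectral_subspaceD bB Eu Ev).
have n2 : rn (u + v) <= 2 by have := rnD u v; rewrite u1 v1; lra.
have h : rn ((mean u - a)%:C *: u + (mean v - a)%:C *: v) <= 4 * d.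
  rewrite u1 v1 !mulr1 in hu hv.
  have : d * rn (u + v) <= d * 2 by rewrite ler_pM2l.
  lra.
have := h; rewrite -(@ler_pXn2r _ 2) ?nnegrE ?rn_ge0 ?mulr_ge0 ?(ltW d0) //.
rewrite rn_comb_orth // uv !mulr0 addr0 => h2.
rewrite -(@ler_pXn2r _ 2) ?nnegrE ?mulr_ge0 ?(ltW d0) // real_normK ?num_real //.
have := sqr_ge0 (mean u - a + (mean v - a)).
have : 0 <= d ^+ 2 by rewrite sqr_ge0.
by move: h2; rewrite !exprMn; nra.
Qed.

(** Split [w] along [u] and its complement. On the orthogonal part the error is [6 d] from the
    comparison of means and [d] from its own mean; the part along [u] adds another [d]. *)
Lemma mean_approx s d u w : 0 < d -> rn u = 1 -> subspace s d u -> subspace s d w ->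
  rn (A w - (mean u)%:C *: w) <= 8 * d * rn w.
Proof.
move=> d0 u1 Eu Ew; have lA := bop_lin bA.
pose a := rd w u; pose w' := w - a%:C *: u.
have ort : rd w' u = 0 by rewrite /w' rdDl rdNl rdZl (rdxx hdot) u1 expr1n mulr1 subrr.
have Ew' : subspace s d w'.
  rewrite /w' -scaleNr; apply: (spectral_subspaceD bB) => //.
  exact: spectral_subspaceZ.
have wE : w = w' + a%:C *: u by rewrite subrK.
clearbody w' a.
have py : rn w ^+ 2 = rn w' ^+ 2 + a ^+ 2.
  rewrite wE.
  rewrite (rn2D hdot) rnZr rdZr ort u1 !mulr1 real_normK ?num_real // mulr0 mulr0 addr0 //.
have aw : `|a| <= rn w.
  by rewrite -(@ler_pXn2r _ 2) ?nnegrE ?rn_ge0 // py real_normK ?num_real // lerDr sqr_ge0.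
have ww : rn w' <= rn w.
  by rewrite -(@ler_pXn2r _ 2) ?nnegrE ?rn_ge0 // py lerDl sqr_ge0.
have hu : rn (A u - (mean u)%:C *: u) <= d.
  apply: le_trans (unit_mean_le s u1) _.
  by have := spectral_subspace_bound hdot bB sB d0 Eu; rewrite u1 mulr1.
have hw' : rn (A w' - (mean u)%:C *: w') <= 7 * d * rn w'.
  have [->|w0] := eqVneq w' 0; first by rewrite (lin0 lA) scaler0 subr0 rn0 mulr0.
  have wp := rn_gt0 w0; have [v [v1 vw wv]] := normalize w0.
  have Ev : subspace s d v by rewrite vw; apply: spectral_subspaceZ.
  have uv : rd u v = 0 by rewrite vw rdZr rdC ort mulr0.
  have hm := mean_close_orth d0 u1 v1 uv Eu Ev.
  have hv : rn (A v - (mean v)%:C *: v) <= d.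
    apply: le_trans (unit_mean_le s v1) _.
    by have := spectral_subspace_bound hdot bB sB d0 Ev; rewrite v1 mulr1.
  have hv2 : rn (A v - (mean u)%:C *: v) <= 7 * d.
    have := rnD3 ((mean v)%:C *: v) (A v) ((mean u)%:C *: v).
    by rewrite -scalerBl -rmorphB rnZr v1 mulr1 distrC; lra.
  have -> : A w' - (mean u)%:C *: w' = (rn w')%:C *: (A v - (mean u)%:C *: v).
    by rewrite {1 2}wv (linZ _ _ lA) scalerBr !scalerA mulrC.
  by rewrite rnZr ger0_norm ?rn_ge0 // mulrC ler_pM2r.
have -> : A w - (mean u)%:C *: w =
    (A w' - (mean u)%:C *: w') + a%:C *: (A u - (mean u)%:C *: u).
  rewrite {1 2}wE.
  rewrite (linD _ _ lA) (linZ _ _ lA) (scalerDr _ w') scalerBr opprD addrACA.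
  by congr (_ + (_ - _)); rewrite !scalerA mulrC.
apply: le_trans (rnD _ _) _; rewrite rnZr.
have : `|a| * rn (A u - (mean u)%:C *: u) <= rn w * d by rewrite ler_pM ?rn_ge0.
have : 7 * d * rn w' <= 7 * d * rn w by rewrite ler_wpM2l // mulr_ge0 // ltW.
lra.
Qed.

(** The smaller subspace lies in the larger, where the error is [8 + 1] times the larger radius. The
    additive form of the bound says that the intervals of radius [9 d] around the means meet
    pairwise. *)
Lemma mean_close s d d' u v : 0 < d -> 0 < d' -> rn u = 1 -> rn v = 1 ->
  subspace s d u -> subspace s d' v -> `|mean u - mean v| <= 9 * d + 9 * d'.
Proof.
wlog dd : d d' u v / d <= d'.
  move=> h d0 d0' u1 v1 Eu Ev; have [|/ltW] := leP d d' => dd; first exact: h.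
  by rewrite distrC [X in _ <= X]addrC; apply: h.
move=> d0 d0' u1 v1 Eu Ev; have Eu' := spectral_subspace_le (ltW d0) dd Eu.
have h1 := mean_approx d0' u1 Eu' Ev.
have h2 : rn (A v - (mean v)%:C *: v) <= d'.
  apply: le_trans (unit_mean_le s v1) _.
  by have := spectral_subspace_bound hdot bB sB d0' Ev; rewrite v1 mulr1.
have := rnD3 (A v) ((mean u)%:C *: v) ((mean v)%:C *: v).
rewrite -scalerBl -rmorphB rnZr v1 mulr1 (rnBC _ (A v)); rewrite v1 mulr1 in h1; lra.
Qed.

(* The value at s of the function f with A = f(B). *)
Definition symbol s : R :=
  sup [set a | exists d u, [/\ 0 < d, rn u = 1, subspace s d u & a = mean u - 9 * d]].

(** The intervals [[mean u - 9 d, mean u + 9 d]] meet pairwise, so the supremum of the left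
    endpoints lies in all of them. *)
Lemma symbolP s d u : spectrum B s%:C -> 0 < d -> rn u = 1 -> subspace s d u ->
  `|mean u - symbol s| <= 9 * d.
Proof.
move=> ss d0 u1 Eu; rewrite /symbol; set V := [set a | _].
have ub d' v : 0 < d' -> rn v = 1 -> subspace s d' v -> ubound V (mean v + 9 * d').
  move=> d0' v1 Ev _ [e [w [e0 w1 Ew ->]]].
  by have := mean_close e0 d0' w1 v1 Ew Ev; rewrite ler_norml => /andP[_]; lra.
have Vu : V (mean u - 9 * d) by exists d, u.
have h1 : sup V <= mean u + 9 * d by apply: ge_sup; [exists (mean u - 9 * d)|exact: ub].
have h2 : mean u - 9 * d <= sup V by apply: ub_le_sup => //; exists (mean u + 9 * d); exact: ub.
by rewrite ler_norml; apply/andP; split; lra.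
Qed.

(** The constant is [8] from [mean_approx] plus [9] from [symbolP]. *)
Lemma symbol_approx s d w : spectrum B s%:C -> 0 < d -> subspace s d w ->
  rn (A w - (symbol s)%:C *: w) <= 17 * d * rn w.
Proof.
move=> ss d0 Ew; have [u u1 Eu] := spectral_subspace_unit ss d0.
have h1 := mean_approx d0 u1 Eu Ew; have h2 := symbolP ss d0 u1 Eu.
have := rnD3 ((mean u)%:C *: w) (A w) ((symbol s)%:C *: w).
rewrite -scalerBl -rmorphB rnZr.
have : `|mean u - symbol s| * rn w <= 9 * d * rn w by rewrite ler_wpM2r ?rn_ge0.
lra.
Qed.
End Core.

(** * Conclusion *)

Section Symbol.
Variables (R : realType) (H : completeNormedModType (cplx R)).
Local Notation C := (cplx R).
Variable dot : {dot H for @Num.conj C}.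
Hypothesis hdot : dot_norm dot.
Local Notation rd := (redot dot).
Variables A B : H -> H.
Hypothesis bA : bounded_operator A.
Hypotheses (bB : bounded_operator B) (sB : self_adjoint dot B).
Local Notation cts := (continuous_on_spectrum B).
Local Notation fc := (cfc dot B).
Local Notation shift := (op_shift B).
Local Notation subspace := (spectral_subspace B).
Implicit Types (x y u v w : H) (s t d : R).
Hypothesis hAB : forall x, rn x = 1 ->
  rn (A x) ^+ 2 - rd (A x) x ^+ 2 <= rn (B x) ^+ 2 - rd (B x) x ^+ 2.
Local Notation symbol := (symbol dot A B).
Local Notation mean := (mean dot A).

(* Approximate eigenvectors u, v of B at s != t are almost orthogonal, so that the
   variance at u + v is about (s - t)^2 / 4 for B, and (f s - f t)^2 / 4 for A. *)
Lemma mean_lipschitz s t d u v : 0 < d -> rn u = 1 -> rn v = 1 ->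
  subspace s d u -> subspace t d v ->
  exists k : R, [/\ 0 <= k <= 1, `|s - t| * k <= 2 * d &
    (1 - k) * (mean u - mean v) ^+ 2 <= `|s - t| ^+ 2 + 18 * d * `|s - t| + 32 * d ^+ 2].
Proof.
move=> d0 u1 v1 Eu Ev; set D : R := `|s - t|; have D0 : 0 <= D by exact: normr_ge0.
have hu := spectral_subspace_bound hdot bB sB d0 Eu; rewrite u1 mulr1 in hu.
have hv := spectral_subspace_bound hdot bB sB d0 Ev; rewrite v1 mulr1 in hv.
pose c := rd u v; exists `|c|.
have c1 : `|c| <= 1 by apply: le_trans (rd_le hdot u v) _; rewrite u1 v1 mulr1.
(* Self-adjointness gives [(s - t) <u, v> = <u, (B - t) v> - <(B - s) u, v>], with both terms at
   most [d]. *)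
have cD : D * `|c| <= 2 * d.
  rewrite -normrM; have -> : (s - t) * c = rd u (shift t v) - rd (shift s u) v.
    by rewrite /op_shift !rdE (rd_sa sB) /c; ring.
  apply: le_trans (ler_normB _ _) _.
  have := rd_le hdot u (shift t v); have := rd_le hdot (shift s u) v.
  by rewrite u1 v1; lra.
split=> //; first by rewrite normr_ge0.
(* Relative to the midpoint, [B - m] maps [u + v] to [(s - t) / 2] times [u - v], up to [2 d]. *)
pose m := (s + t) / 2; have [a ha] := mean_combination hdot bA bB hAB s t m u1 v1.
pose r := rn (u - v).
have r0 : 0 <= r by exact: rn_ge0.
have r2 : r <= 2 by rewrite /r; have := rnB u v; rewrite u1 v1; lra.
have rr : r ^+ 2 <= 2 + 2 * `|c|.
  by rewrite /r (rn2B hdot) u1 v1 -/c; have := ler_norm (- c); rewrite normrN; lra.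
have hm : rn (shift m (u + v)) <= 2 * d + D / 2 * r.
  have -> : shift m (u + v) = shift s u + shift t v + ((s - t) / 2)%:C *: (u - v).
    apply: (dot_ext hdot) => z; rewrite /op_shift (linD _ _ (bop_lin bB)) !rdE.
    by rewrite /m; lra.
  apply: le_trans (rnD _ _) _; have := rnD (shift s u) (shift t v).
  by rewrite rnZr normrM (@ger0_norm _ 2^-1) ?invr_ge0 // -/D -/r; lra.
have h : rn ((mean u - a)%:C *: u + (mean v - a)%:C *: v) <= 4 * d + D / 2 * r by lra.
have Dr0 : 0 <= D / 2 * r by rewrite mulr_ge0 // divr_ge0.
have : rn ((mean u - a)%:C *: u + (mean v - a)%:C *: v) ^+ 2 <= (4 * d + D / 2 * r) ^+ 2.
  by rewrite ler_pXn2r ?nnegrE ?rn_ge0 // addr_ge0 // mulr_ge0 // ltW.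
rewrite (rn_comb_orth hdot) // -/c.
set p := mean u - a; set q := mean v - a => h2.
have -> : mean u - mean v = p - q by rewrite /p /q; ring.
(* The overlap costs at most the factor [1 - |c|], and [(p - q)^2 <= 2 (p^2 + q^2)] eliminates the
   unknown [a]. *)
have h3 : - (`|c| * (p ^+ 2 + q ^+ 2)) <= 2 * (p * q * c).
  have e1 := sqr_ge0 (p - q); have e2 := sqr_ge0 (p + q).
  have [c0|c0] := ler0P c; nra.
have h4 : (1 - `|c|) * (p - q) ^+ 2 <= (1 - `|c|) * (2 * (p ^+ 2 + q ^+ 2)).
  by rewrite ler_wpM2l ?subr_ge0 //; have := sqr_ge0 (p + q); lra.
have h5 : (4 * d + D / 2 * r) ^+ 2 = 16 * d ^+ 2 + 4 * d * (D * r) + D ^+ 2 * r ^+ 2 / 4.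
  by field.
have h6 : d * (D * r) <= d * (D * 2) by rewrite ler_pM2l // ler_wpM2l.
have h7 : D ^+ 2 * r ^+ 2 <= D ^+ 2 * (2 + 2 * `|c|) by rewrite ler_wpM2l ?sqr_ge0.
have h8 : D * (D * `|c|) <= D * (2 * d) by rewrite ler_wpM2l.
have : D ^+ 2 * (2 + 2 * `|c|) = 2 * D ^+ 2 + 2 * (D * (D * `|c|)) by ring.
lra.
Qed.

Lemma symbol_lipschitz s t : spectrum B s%:C -> spectrum B t%:C ->
  `|symbol s - symbol t| <= `|s - t|.
Proof.
move=> ss st; have [->|st0] := eqVneq s t; first by rewrite !subrr.
set D : R := `|s - t|; have D0 : 0 < D by rewrite normr_gt0 subr_eq0.
set F : R := `|symbol s - symbol t|; rewrite leNgt; apply/negP => DF.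
(* [K] collects the coefficients of all errors of order [d]: the loss [18 d] in [F], the overlap
   [k <= 2 d / D], and the last two terms of [mean_lipschitz], using [d^2 <= d]. As
   [F^2 - D^2 > (F - D)^2], [d K <= G^2] is contradictory. *)
pose K := 36 * F + 2 / D * F ^+ 2 + 18 * D + 32.
have F0 : 0 < F by apply: lt_trans DF.
have K0 : 0 < K.
  have : 0 <= 2 / D * F ^+ 2 by rewrite mulr_ge0 ?sqr_ge0 // divr_ge0 // ltW.
  by rewrite /K; lra.
pose G := F - D; have G0 : 0 < G by rewrite subr_gt0.
have F18 : 0 < F / 18 by lra.
have GK : 0 < G ^+ 2 / K by rewrite divr_gt0 // exprn_gt0.
have [d [d0 d1 d2 d3]] : exists d, [/\ 0 < d, d <= 1, d <= F / 18 & d <= G ^+ 2 / K].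
  exists (Num.min 1 (Num.min (F / 18) (G ^+ 2 / K))).
  by rewrite !lt_min !ge_min !lexx ltr01 F18 GK !orbT.
have [u u1 Eu] := spectral_subspace_unit hdot bB sB ss d0.
have [v v1 Ev] := spectral_subspace_unit hdot bB sB st d0.
have [k [/andP[k0 k1] kD hk]] := mean_lipschitz d0 u1 v1 Eu Ev; rewrite -/D in kD hk.
have hs := symbolP hdot bA bB sB hAB ss d0 u1 Eu.
have ht := symbolP hdot bA bB sB hAB st d0 v1 Ev.
have hL : F - 18 * d <= `|mean u - mean v|.
  have h1 := ler_distD (mean u) (symbol s) (symbol t).
  have h2 := ler_distD (mean v) (mean u) (symbol t).
  by rewrite (distrC (symbol s) (mean u)) -/F in h1; lra.
have hL2 : (F - 18 * d) ^+ 2 <= (mean u - mean v) ^+ 2.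
  rewrite -[X in _ <= X]real_normK ?num_real // ler_pXn2r ?nnegrE //; lra.
have h1 : (1 - k) * (F - 18 * d) ^+ 2 <= (1 - k) * (mean u - mean v) ^+ 2.
  by rewrite ler_wpM2l // subr_ge0.
have kD2 : k <= 2 * d / D by rewrite ler_pdivlMr // mulrC.
have h2 : k * (F - 18 * d) ^+ 2 <= 2 * d / D * F ^+ 2.
  apply: ler_pM => //; first exact: sqr_ge0.
  by rewrite ler_pXn2r ?nnegrE //; lra.
have h3 : d * K <= G ^+ 2 by rewrite -ler_pdivlMr.
have h4 : d ^+ 2 <= d by rewrite expr2 ger_pMr.
have h5 : d * K = 36 * (d * F) + 2 * d / D * F ^+ 2 + 18 * (d * D) + 32 * d.
  by rewrite /K; field; rewrite gt_eqF.
have h6 : 0 <= d ^+ 2 by rewrite sqr_ge0.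
have h7 : G ^+ 2 = F ^+ 2 - 2 * (D * F) + D ^+ 2 by rewrite /G; ring.
have h8 : D * D < D * F by rewrite ltr_pM2l.
nra.
Qed.

Lemma fc_sum n (F : nat -> C -> C) x : (forall k, cts (F k)) ->
  cts (fun z => \sum_(k < n) F k z) /\
  fc (fun z => \sum_(k < n) F k z) x = \sum_(k < n) fc (F k) x.
Proof.
move=> cF; have isf := cfcP hdot bB sB; elim: n => [|n [IH1 IH2]].
  have c0 := @cts_cst _ _ B (1 : C).
  have -> : (fun z => \sum_(k < 0) F k z) = (fun z => 0 * 1 : C).
    by apply: funext => z; rewrite big_ord0 mul0r.
  split; first exact: (cts_scale c0).
  by rewrite (cfc_scale isf _ c0) big_ord0 scale0r.
have -> : (fun z => \sum_(k < n.+1) F k z) = (fun z => \sum_(k < n) F k z) \+ F n.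
  by apply: funext => z; rewrite big_ord_recr.
split; first exact: (ctsD IH1 (cF n)).
by rewrite (cfc_add isf IH1 (cF n)) /= IH2 big_ord_recr.
Qed.

Lemma symbol_cos : cts (fun z => (symbol (Re z))%:C).
Proof.
apply: (lipschitz_cos (L := 1)) => z w sz sw; rewrite mul1r.
apply: le_trans (symbol_lipschitz _ _) _; rewrite -?(spectrumE hdot bB sB) //.
by rewrite -cReN -cReD Re_le_cabs.
Qed.

(** The centre [s] may be off the spectrum, where [symbol] is uncontrolled. A spectral point [z0] in
    the support takes its place at radius [2 d], whence [17 * 2 d + 2 d]; without such a point the
    piece is zero. *)
Lemma tent_piece s d x y : 0 < d -> y = fc (fun z => (tent ((Re z - s) / d))%:C) x ->
  rn (A y - fc (fun z => (symbol (Re z))%:C) y) <= 36 * d * rn y.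
Proof.
move=> d0 ->; have ct := @tent_cos _ _ B s d d0.
set g := (fun z : C => (tent ((Re z - s) / d))%:C) in ct *.
have isf := cfcP hdot bB sB; have csym := symbol_cos.
have [[z0 [sz0 gz0]]|none] := pselect (exists z, spectrum B z /\ g z != 0); last first.
  suff -> : fc g x = 0.
    by rewrite (lin0 (bop_lin bA)) (lin0 (fc_linear hdot bB sB csym)) subr0 rn0 mulr0.
  have c0 := @cts_cst _ _ B (1 : C).
  apply: rn_eq0; apply/eqP; rewrite eq_le rn_ge0 andbT.
  apply: le_trans (fc_le hdot bB sB x ct (cts_scale (a := 0) c0) _) _.
    move=> z sz; suff -> : g z = 0 by rewrite mul0r.
    by apply: contrapT => /eqP h; apply: none; exists z.
  by rewrite (cfc_scale isf _ c0) scale0r rn0.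
have near (z : C) : g z != 0 -> `|Re z - s| <= d.
  move=> gz; have := tent_support s z d0; rewrite -/(g z) ler_pM2r //.
  by rewrite lt_neqAle cabs_ge0 andbT eq_sym; apply: contra gz => /eqP/cabs_eq0->.
have supp (z : C) : `|Re z - Re z0| * cabs (g z) <= 2 * d * cabs (g z).
  have [->|/near h] := eqVneq (g z) 0; first by rewrite /cabs normr0 !mulr0.
  rewrite ler_wpM2r ?cabs_ge0 //; have := near _ gz0.
  by have := ler_distD s (Re z) (Re z0); rewrite (distrC s (Re z0)); lra.
have d20 : 0 < 2 * d by lra.
have sz0' : spectrum B (Re z0)%:C by rewrite -(spectrumE hdot bB sB).
have Ey : subspace (Re z0) (2 * d) (fc g x).
  by apply: (fc_spectral_subspace hdot bB sB x (ltW d20) ct) => z _; exact: supp.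
have h1 := symbol_approx hdot bA bB sB hAB sz0' d20 Ey.
have cs : cts (fun z => (symbol (Re z))%:C - (symbol (Re z0))%:C).
  by have := ctsD csym (@cts_cst _ _ B (- (symbol (Re z0))%:C)).
have h2 : rn ((symbol (Re z0))%:C *: fc g x - fc (fun z => (symbol (Re z))%:C) (fc g x))
    <= 2 * d * rn (fc g x).
  rewrite rnBC -(fc_sub_cst hdot bB sB _ _ csym) -(fc_mul hdot bB sB x cs ct).
  have -> : 2 * d * rn (fc g x) = rn (fc (fun z => (2 * d)%:C * g z) x).
    by rewrite (cfc_scale isf _ ct) rnZr gtr0_norm.
  apply: (fc_le hdot bB sB x (ctsM cs ct) (cts_scale ct)) => z sz.
  rewrite !cabsM -rmorphB (cabsR (symbol _ - _)) (cabsR (2 * d)) (gtr0_norm d20).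
  apply: le_trans (supp z); rewrite ler_wpM2r ?cabs_ge0 //.
  by apply: symbol_lipschitz; rewrite // -(spectrumE hdot bB sB).
have := rnD3 ((symbol (Re z0))%:C *: fc g x) (A (fc g x))
  (fc (fun z => (symbol (Re z))%:C) (fc g x)).
lra.
Qed.

Lemma cfc_symbol : A = fc (fun z => (symbol (Re z))%:C).
Proof.
apply: funext => x; apply/eqP; rewrite -subr_eq0; apply/eqP/rn_small => e e0.
have csym := symbol_cos; set S := fc _; have lS : linear S by exact: fc_linear.
have [M M0 hM] := spectrum_bounded hdot bB sB.
have c0 : 0 <= 36 * M * (2 + rn x ^+ 2).
  by apply: mulr_ge0; [rewrite mulr_ge0 // ltW|rewrite addr_ge0 // sqr_ge0].
(* The mesh is [2 M / m^2], a square number of pieces, so that the square root in the Cauchy-Schwarz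
   estimate is the integer [m]. *)
have [m hm] := natr_gt (36 * M * (2 + rn x ^+ 2) / e).
have m0 : 0 < m%:R :> R by apply: le_lt_trans hm; rewrite divr_ge0 // ltW.
have mN : (1 : R) <= m%:R by rewrite ler1n -(ltr0n R).
pose d := 2 * M / (m ^ 2)%:R; have m20 : 0 < (m ^ 2)%:R :> R by rewrite natrX exprn_gt0.
have d0 : 0 < d by rewrite divr_gt0 // mulr_gt0.
pose n := (m ^ 2)%N; pose s (k : nat) := - M + k%:R * d.
pose g k (z : C) : C := (tent ((Re z - s k) / d))%:C.
have cg k : cts (g k) by apply: tent_cos.
have gsum z : spectrum B z -> \sum_(k < n.+1) tent ((Re z - s k) / d) = 1.
  (* The shift by 1 moves the rescaled interval [[0, n]] to [[1, n + 1]], the centre [s k] going to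
     [k + 1]. *)
  move=> sz; rewrite -[RHS](@tent_sum _ n ((Re z + M) / d + 1)).
    apply: eq_bigr => k _; congr tent; rewrite /s -natr1; field; exact: lt0r_neq0.
  have := hM z sz; rewrite ler_norml => /andP[h1 h2].
  apply/andP; split; first by rewrite lerDr divr_ge0 ?(ltW d0) //; lra.
  by rewrite -natr1 lerD2r ler_pdivrMr // /d /n mulrC divfK ?gt_eqF //; lra.
have xE : x = \sum_(k < n.+1) fc (g k) x.
  have [_ <-] := fc_sum n.+1 x cg; have isf := cfcP hdot bB sB.
  have /(congr1 (@^~ x)) /= {1}<- := cfc_one isf.
  have e1 : fc (fun=> 1) = fc (fun z => \sum_(k < n.+1) g k z).
    apply: (cfc_ext isf (@cts_cst _ _ B (1 : C)) (fc_sum n.+1 x cg).1). move=> w sw.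
    by rewrite -[1]/(1%:C) -(gsum w sw) rmorph_sum.
  by rewrite e1.
have sq k : rn (fc (g k) x) ^+ 2 = rd (fc (fun z => Num.conj (g k z) * g k z) x) x.
  exact: (fc_norm2 hdot bB sB x (cg k)).
have cg2 k : cts (fun z => Num.conj (g k z) * g k z) by exact: (cts_abs2 (cg k)).
(* The pieces need not be orthogonal; as [tent^2 <= tent], the squares of the partition still sum to
   at most 1 on the spectrum. *)
have sum2 : \sum_(k < n.+1) rn (fc (g k) x) ^+ 2 <= rn x ^+ 2.
  have [cs e2] := fc_sum n.+1 x cg2.
  have -> : \sum_(k < n.+1) rn (fc (g k) x) ^+ 2 =
      rd (fc (fun z => \sum_(k < n.+1) Num.conj (g k z) * g k z) x) x.
    rewrite e2; under eq_bigr do rewrite sq.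
    by elim: {+}n.+1 => [|j IH]; rewrite ?big_ord0 ?rd0l // !big_ord_recr /= rdDl IH.
  apply: le_trans (ler_norm _) _; apply: le_trans (rd_le hdot _ _) _.
  rewrite expr2 ler_wpM2r ?rn_ge0 //.
  have isf := cfcP hdot bB sB.
  have /(congr1 (@^~ x)) /= {2}<- := cfc_one isf.
  apply: (fc_le hdot bB sB x cs (@cts_cst _ _ B (1 : C))) => z sz.
  have -> : \sum_(k < n.+1) Num.conj (g k z) * g k z =
      (\sum_(k < n.+1) tent ((Re z - s k) / d) ^+ 2)%:C.
    rewrite rmorph_sum; apply: eq_bigr => k _; rewrite mulrC mulJ /g cabsR.
    by rewrite real_normK ?num_real.
  rewrite cabsR -[1]/(1%:C) cabsR normr1 ger0_norm ?sumr_ge0 // => [|k _]; last exact: sqr_ge0.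
  rewrite -(gsum z sz); apply: ler_sum => k _.
  have [t0 t1 _ _] := tentP ((Re z - s k) / d).
  by rewrite expr2 ler_piMr.
have step : rn (A x - S x) <= \sum_(k < n.+1) 36 * d * rn (fc (g k) x).
  rewrite {1 2}xE (lin_sum _ _ _ (bop_lin bA)) (lin_sum _ _ _ lS) -sumrB.
  elim/big_ind2: _ => [|y y' b b' h h'|k _]; first by rewrite rn0.
    by apply: le_trans (rnD _ _) _; exact: lerD.
  exact: (tent_piece d0 erefl).
apply: le_trans step _; rewrite -mulr_sumr.
(* Cauchy-Schwarz in weighted form: the weight [m] balances about [m^2] terms [1 / m] against
   [m |x|^2], so the norms sum to [O(m)] and, times [d], the total error is [O(1 / m)]. *)
have amgm k : rn (fc (g k) x) <= (m%:R^-1 + m%:R * rn (fc (g k) x) ^+ 2) / 2.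
  have := sqr_ge0 (m%:R * rn (fc (g k) x) - 1); move: (rn _) => a h.
  rewrite -(ler_pM2l m0) mulrA mulrDr divff ?gt_eqF //; nra.
have sum1 : \sum_(k < n.+1) rn (fc (g k) x) <= ((m%:R ^+ 2 + 1) / m%:R + m%:R * rn x ^+ 2) / 2.
  apply: (@le_trans _ _ (\sum_(k < n.+1) (m%:R^-1 + m%:R * rn (fc (g k) x) ^+ 2) / 2)).
    by apply: ler_sum => k _; exact: amgm.
  rewrite -mulr_suml ler_pM2r //.
  rewrite big_split /= sumr_const card_ord -mulr_sumr; apply: lerD.
    have -> : m%:R ^+ 2 + 1 = n.+1%:R :> R by rewrite -natr1 /n natrX.
    by rewrite mulr_natl.
  by rewrite ler_pM2l.
apply: le_trans (ler_wpM2l _ sum1) _; first by rewrite mulr_ge0 // ltW.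
have -> : 36 * d * (((m%:R ^+ 2 + 1) / m%:R + m%:R * rn x ^+ 2) / 2) =
   36 * M * ((m%:R ^+ 2 + 1) / m%:R ^+ 2 + rn x ^+ 2) / m%:R.
  by rewrite /d natrX; field; exact: lt0r_neq0.
have hm' : 36 * M * (2 + rn x ^+ 2) <= e * m%:R.
  by move: hm; rewrite ltr_pdivrMr // [_ * e]mulrC => /ltW.
rewrite ler_pdivrMr //; apply: le_trans hm'.
rewrite ler_wpM2l ?mulr_ge0 ?(ltW M0) // lerD2r ler_pdivrMr ?exprn_gt0 //.
by have : 1 <= m%:R ^+ 2 :> R by [rewrite exprn_ege1]; lra.
Qed.
End Symbol.

Theorem theorem2p1 (R : realType) (H : completeNormedModType (cplx R))
    (dot : {dot H for @Num.conj (cplx R)}) (hdot : dot_norm dot)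
    (A B : H -> H) (bA : bounded_operator A) (bB : bounded_operator B)
    (sA : self_adjoint dot A) (sB : self_adjoint dot B) :
  [<-> forall x : H, `|x| = 1 ->
         state_variance dot (pure_state dot x) A <= state_variance dot (pure_state dot x) B;
       forall rho : H -> H, state dot rho ->
         state_variance dot rho A <= state_variance dot rho B;
       exists f : cplx R -> R,
         (forall s t : cplx R, spectrum B s -> spectrum B t ->
            `|f s - f t|%:C <= `|s - t|) /\
         A = cfc dot B (fun z => (f z)%:C)].
Proof.
set P1 := forall x, _; set P2 := forall rho, _; set P3 := exists f, _.
have h13 : P1 -> P3.
  move=> h; have hAB x : rn x = 1 ->
      rn (A x) ^+ 2 - redot dot (A x) x ^+ 2 <= rn (B x) ^+ 2 - redot dot (B x) x ^+ 2.
    by move=> x1; have := h x; rewrite normE x1 !(pure_variance hdot) // lecR; apply.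
  exists (fun z => symbol dot A B (Re z)); split; last exact: cfc_symbol.
  move=> s t ss st; rewrite cabsE lecR.
  apply: le_trans (symbol_lipschitz hdot bA bB sB hAB _ _) _.
  - by rewrite -(spectrumE hdot bB sB).
  - by rewrite -(spectrumE hdot bB sB).
  by rewrite -cReN -cReD Re_le_cabs.
have h32 : P3 -> P2.
  move=> [f [hf fE]] rho hrho; apply: variance_le => // m.
  have [|c hc] := @lipschitz_cfc_shift _ _ _ hdot _ bB sB f m.
    by move=> s t ss st; have := hf s t ss st; rewrite cabsE lecR.
  by exists c; rewrite {1}fE.
have h21 : P2 -> P1.
  move=> h x x1; apply: h; apply: pure_state_is_state => //.
  by rewrite /rn x1.
by tfae; [move/h13/h32|move/h21/h13|move/h32/h21].
Qed.
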